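(* Let $T\ge 1$ be an integer, $\delta\in(0,1)$, assume $\Delta(K_0)>0$ and let $\Delta=6\Delta(K_0)$. Suppose the stochastic gradient oracle satisfies the Noise Condition stated in the context, and that $G_\Delta\big(b+\sqrt{V_\Delta\delta}\big)/\mu\le \Delta(K_0)$. Denote $$D=\frac{8L_\Delta}{\mu^2}\Big[M_{\Delta,\delta}^2+768(M_{\Delta,\delta}+G_\Delta)^2\log(1/\delta)\Big],\quad N=\left\lceil\max\left\{4,\ \frac{2M_{\Delta,\delta}}{\mu r_\Delta},\ \frac{D}{\Delta(K_0)}\right\}\right\rceil,\quad C=2\big(N\Delta(K_0)+D\big).$$ Run the stochastic policy gradient method with stepsizes $\eta_t=\frac{2}{\mu(N+t)}$. Then with probability at least $1-2T\delta$, $$\Delta(K_t)\le \frac{2G_\Delta\big(b+\sqrt{V_\Delta\delta}\big)}{\mu}+\frac{C}{N+t}\qquad\text{for all } 0\le t\le T .$$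
   Context: LQR problem. Let $A\in\mathbb{R}^{n\times n}$, $B\in\mathbb{R}^{n\times m}$, let $Q\in\mathbb{R}^{n\times n}$, $R\in\mathbb{R}^{m\times m}$ be symmetric positive definite, and let $\mathcal{D}$ be a distribution on $\mathbb{R}^n$ with $\mathbb{E}_{x_0\sim\mathcal{D}}[x_0x_0^\top]=I_n$ and $\|x_0\|\le D_X$ for some $D_X>0$. For a policy $K\in\mathbb{R}^{m\times n}$ let $f(K)=\mathbb{E}_{x_0\sim\mathcal{D}}\big[\sum_{i\ge0}(x_i^\top Qx_i+a_i^\top Ra_i)\big]\in[0,+\infty]$, where $x_{i+1}=Ax_i+Ba_i$, $a_i=-Kx_i$. Let $f^*=\min_K f(K)$, assumed finite, and $\Delta(K)=f(K)-f^*$. A policy $K$ is stable if $\rho(A-BK)<1$ ($\rho$ is the spectral radius); this is equivalent to $\Delta(K)<\infty$. $\|\cdot\|$ is the Euclidean norm of vectors and the Frobenius norm of matrices, $\langle\cdot,\cdot\rangle$ the associated inner product. Stochastic policy gradient (SPG). From a fixed stable $K_0$, iterate $K_{t+1}=K_t-\eta_tG_t$, $t\ge0$, where $G_t$ is a stochastic estimate of $\nabla f(K_t)$. $\mathcal{F}_t$ is the filtration up to iteration $t$, excluding $t$ (so $K_t$ is $\mathcal{F}_t$-measurable and $G_t$ is $\mathcal{F}_{t+1}$-measurable). Noise Condition. For any $\Delta>0$ and $\delta\in(0,1)$ there exist $b\ge0$, $V_\Delta>0$, $M_{\Delta,\delta}>0$ such that, for any $K_t$ with $\Delta(K_t)\le\Delta$: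 (i) $\|\mathbb{E}[G_t|\mathcal{F}_t]-\nabla f(K_t)\|\le b$; (ii) $\mathbb{E}[\|G_t\|^2|\mathcal{F}_t]\le V_\Delta$; (iii) $\mathbb{P}(\|G_t\|\le M_{\Delta,\delta}\,|\,\mathcal{F}_t)\ge1-\delta$. Landscape constants. $\mu>0$ (independent of $\Delta$) and, for each $\Delta>0$, $L_\Delta,r_\Delta>0$ are fixed constants such that for every policy $K$ with $\Delta(K)<\Delta$: every $K'$ with $\|K'-K\|\le r_\Delta$ is stable and satisfies $f(K')\le f(K)+\langle\nabla f(K),K'-K\rangle+\frac{L_\Delta}{2}\|K-K'\|^2$; and $\mu\Delta(K)\le\|\nabla f(K)\|^2\le2L_\Delta\Delta(K)$. (Such constants are known to exist for LQR.) Also $G_\Delta=2\sqrt{L_\Delta\Delta}$. *)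

(* Defs.v *)
From HB Require Import structures.
From mathcomp Require Import all_boot all_order all_algebra.
From mathcomp Require Import all_classical all_reals all_analysis.
From mathcomp Require Import complex.

Set Implicit Arguments.
Unset Strict Implicit.
Unset Printing Implicit Defensive.

Import Order.TTheory GRing.Theory Num.Theory.
Import numFieldNormedType.Exports.

Local Open Scope classical_set_scope.
Local Open Scope ring_scope.

Section Matrices.
Variable R : realType.

(* The library norm `|M| on matrices is the max norm, hence the following. *)
Definition frob_inner (p q : nat) (X Y : 'M[R]_(p, q)) : R := \tr (X^T *m Y).

Definition frob_norm (p q : nat) (X : 'M[R]_(p, q)) : R :=
  Num.sqrt (frob_inner X X).

Definition quad_form (n : nat) (M : 'M[R]_n) (x : 'cV[R]_n) : R :=
  (x^T *m M *m x) 0 0.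

Definition sym_posdef (n : nat) (M : 'M[R]_n) : Prop :=
  M^T = M /\ (forall x : 'cV[R]_n, x != 0 -> 0 < quad_form M x).

(* Eigenvalues are taken in the complex numbers; for n = 0 this is sup set0,
   which is 0. *)
Definition spectral_radius (n : nat) (M : 'M[R]_n) : R :=
  sup [set ComplexField.Normc.normc l |
        l in [set l : R[i] | eigenvalue (map_mx (real_complex R) M) l]].

Definition borel_mx (p q : nat) : measurableType _ :=
  g_sigma_algebraType (@open 'M[R]_(p, q)).

Definition gradient (p q : nat) (f : 'M[R]_(p, q) -> R) (K : 'M[R]_(p, q)) :
    'M[R]_(p, q) :=
  \matrix_(i, j) 'D_(delta_mx i j) f K.

End Matrices.

Section LQR.
Variables (R : realType) (n m : nat).
Variables (A : 'M[R]_n) (B : 'M[R]_(n, m)) (Q : 'M[R]_n) (Rc : 'M[R]_m).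
Variable D : probability (borel_mx R n 1) R.

Definition isotropic_bounded (DX : R) : Prop :=
  (forall i j : 'I_n,
      (\int[D]_x ((x : 'cV[R]_n) i 0 * (x : 'cV[R]_n) j 0)%:E
       = ((1%:M : 'M[R]_n) i j)%:E)%E) /\
  {ae D, forall x, frob_norm (x : 'cV[R]_n) <= DX}.

Definition lqr_action (K : 'M[R]_(m, n)) (x : 'cV[R]_n) : 'cV[R]_m :=
  - (K *m x).

Definition lqr_state (K : 'M[R]_(m, n)) (x0 : 'cV[R]_n) (i : nat) : 'cV[R]_n :=
  iter i (fun x => A *m x + B *m lqr_action K x) x0.

Definition lqr_stage_cost (K : 'M[R]_(m, n)) (x : 'cV[R]_n) : R :=
  quad_form Q x + quad_form Rc (lqr_action K x).

Definition lqr_cost (K : 'M[R]_(m, n)) : \bar R :=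
  (\int[D]_x0 \sum_(0 <= i <oo) (lqr_stage_cost K (lqr_state K x0 i))%:E)%E.

Definition lqr_opt : \bar R := ereal_inf (range lqr_cost).

Definition lqr_min_finite : Prop :=
  lqr_opt \is a fin_num /\ exists K, lqr_cost K = lqr_opt.

Definition lqr_subopt (K : 'M[R]_(m, n)) : \bar R := (lqr_cost K - lqr_opt)%E.

Definition lqr_grad (K : 'M[R]_(m, n)) : 'M[R]_(m, n) :=
  gradient (fun K' => fine (lqr_cost K')) K.

Definition stable (K : 'M[R]_(m, n)) : Prop :=
  spectral_radius (A - B *m K) < 1.

Definition landscape (mu : R) (L r : R -> R) : Prop :=
  0 < mu /\
  forall Delta : R, 0 < Delta ->
  [/\ 0 < L Delta, 0 < r Delta &
      forall K : 'M[R]_(m, n), (lqr_subopt K < Delta%:E)%E ->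
      [/\ forall K' : 'M[R]_(m, n), frob_norm (K' - K) <= r Delta ->
            stable K' /\
            (lqr_cost K' <= lqr_cost K
               + (frob_inner (lqr_grad K) (K' - K)
                  + L Delta / 2 * frob_norm (K - K') ^+ 2)%:E)%E,
          (mu%:E * lqr_subopt K <= (frob_norm (lqr_grad K) ^+ 2)%:E)%E &
          ((frob_norm (lqr_grad K) ^+ 2)%:E
             <= (2 * L Delta)%:E * lqr_subopt K)%E]].

End LQR.

Section Filtrations.
Variables (R : realType) (d : measure_display) (T : measurableType d).

Definition filtration (F : nat -> set (set T)) : Prop :=
  [/\ forall t, sigma_algebra [set: T] (F t),
      forall t, F t `<=` measurable &
      forall t, F t `<=` F t.+1].

Definition measurable_wrt d' (U : measurableType d') (F : set (set T))
    (X : T -> U) : Prop :=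
  forall V : set U, measurable V -> F (X @^-1` V).

(* Y is a version, on the event S, of the conditional expectation E[X | F];
   S = setT is the textbook definition.  The localization matters because X
   need not be integrable outside S. *)
Definition condexp_on (P : probability T R) (F : set (set T)) (S : set T)
    (X Y : T -> R) : Prop :=
  [/\ measurable_wrt F Y,
      P.-integrable S (EFin \o X),
      P.-integrable S (EFin \o Y) &
      forall E : set T, F E -> E `<=` S ->
        (\int[P]_(w in E) (Y w)%:E = \int[P]_(w in E) (X w)%:E)%E].

End Filtrations.

Section NoiseCondition.
Variables (R : realType) (n m : nat).
Variables (A : 'M[R]_n) (B : 'M[R]_(n, m)) (Q : 'M[R]_n) (Rc : 'M[R]_m).
Variable D : probability (borel_mx R n 1) R.
Variables (d : measure_display) (T : measurableType d) (P : probability T R).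
Variables (F : nat -> set (set T)) (K G : nat -> T -> 'M[R]_(m, n)).

Definition noise_bounds (Delta delta b V M : R) (t : nat) : Prop :=
  let S := [set w | (lqr_subopt A B Q Rc D (K t w) <= Delta%:E)%E] in
  [/\ exists2 Y : T -> 'M[R]_(m, n),
        forall i j, condexp_on P (F t) S (fun w => G t w i j)
                                         (fun w => Y w i j) &
        {ae P, forall w, S w ->
           frob_norm (Y w - lqr_grad A B Q Rc D (K t w)) <= b},
      exists2 Y : T -> R,
        condexp_on P (F t) S (fun w => frob_norm (G t w) ^+ 2) Y &
        {ae P, forall w, S w -> Y w <= V} &
      exists2 Y : T -> R,
        condexp_on P (F t) S (\1_[set w | frob_norm (G t w) <= M]) Y &
        {ae P, forall w, S w -> 1 - delta <= Y w}].

Definition noise_condition (b : R -> R -> R) (V : R -> R) (M : R -> R -> R) :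
    Prop :=
  forall Delta delta : R, 0 < Delta -> 0 < delta < 1 ->
  [/\ 0 <= b Delta delta, 0 < V Delta, 0 < M Delta delta &
      forall t, noise_bounds Delta delta
                  (b Delta delta) (V Delta) (M Delta delta) t].

End NoiseCondition.

(* Main.v *)
(** The bound [2 B + C / (N + t)], [B] being the bias term, is propagated along
the event where it has held so far: there the iterates stay in the region
[Delta (K t) < 6 Delta (K 0)] in which the landscape constants apply.  When
moreover [|G t| <= M], the step is at most [r], and the quadratic upper bound
together with the PL inequality contracts the suboptimality by the factor
[1 - 2 / (N + t)], up to the noise [<g, g - Z>] where [g] is the gradient and
[Z] is [G t] truncated at [M]; truncation adds [sqrt (V delta)] to the bias [b].
Multiplied by [(N + t) (N + t - 1)], the recursion telescopes.  Since
[|g|^2 <= 2 L Delta (K t)], the noise stopped at the first failure of the bound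
has deterministic ranges, and a Chernoff bound based on [e^x <= x + e^(2 x^2)]
controls its weighted sum at each time outside an event of probability [delta].
These [T] events and the [T] truncation events have total probability at most
[2 T delta].

The cost is Borel because, [D] being isotropic, it is a series of traces of
polynomials in [K]; it is finite at a stable policy because the powers of a
matrix of spectral radius less than 1 are summable. *)

Require Import Defs.
From HB Require Import structures.
From mathcomp Require Import all_boot all_order all_algebra.
From mathcomp Require Import all_classical all_reals all_analysis.
From mathcomp Require Import measurable_realfun complex ring lra.

Import Order.TTheory GRing.Theory Num.Theory.
Import numFieldNormedType.Exports.

Local Open Scope classical_set_scope.
Local Open Scope ring_scope.

Set Implicit Arguments.
Unset Strict Implicit.
Unset Printing Implicit Defensive.

(** The rate [1 / (N + t)], where a plain concentration bound would give its square root, comes from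
    feeding the bound back into the noise: the range of the noise at time [s] is proportional to the
    square root of the bound at time [s]. With weights of order [N + s], the squared ranges up to
    time [t] sum to order [n^2 (Bias n + C)], where [n = N + t - 1]. A Chernoff parameter of order
    [1 / n] turns this into a deviation of order [n (Bias n + C)], which after division by the
    weight [n (n - 1)] has the shape of the bound itself; the factor 2 before the bias and the size
    of [C] leave room to close the induction. Conditional expectations are given only where the
    suboptimality is at most [Delta], and only up to null sets, so exponential moments are
    controlled through integrals against bounded nonnegative [F t]-measurable weights. The gradient
    has to be measurable to serve as a factor there, but it is made of limits of difference
    quotients of a cost whose differentiability is not given; its measurability is extracted from
    the quadratic upper bound. *)

(** * The Frobenius inner product and norm *)

Section Frobenius.
Variables (R : realType) (p q : nat).
Implicit Types X Y Z : 'M[R]_(p, q).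

Lemma frob_innerE X Y : frob_inner X Y = \sum_i \sum_j X i j * Y i j.
Proof.
rewrite /frob_inner /mxtrace exchange_big /=; apply: eq_bigr => j _.
by rewrite mxE; apply: eq_bigr => i _; rewrite mxE.
Qed.

Lemma frob_innerC X Y : frob_inner X Y = frob_inner Y X.
Proof. by rewrite /frob_inner -mxtrace_tr trmx_mul trmxK. Qed.

Lemma frob_innerBr X Y Z :
  frob_inner X (Y - Z) = frob_inner X Y - frob_inner X Z.
Proof. by rewrite /frob_inner mulmxBr raddfB. Qed.

Lemma frob_innerBl X Y Z :
  frob_inner (X - Y) Z = frob_inner X Z - frob_inner Y Z.
Proof. by rewrite -!(frob_innerC Z) frob_innerBr. Qed.

Lemma frob_innerZr a X Y : frob_inner X (a *: Y) = a * frob_inner X Y.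
Proof. by rewrite /frob_inner -scalemxAr mxtraceZ. Qed.

Lemma frob_innerZl a X Y : frob_inner (a *: X) Y = a * frob_inner X Y.
Proof. by rewrite !(frob_innerC _ Y) frob_innerZr. Qed.

Lemma frob_inner_delta X (i : 'I_p) (j : 'I_q) :
  frob_inner X (delta_mx i j) = X i j.
Proof.
rewrite frob_innerE (bigD1 i) //= (bigD1 j) //= !mxE !eqxx mulr1.
rewrite big1 ?addr0 => [|k /negPf kj]; last by rewrite mxE kj andbF mulr0.
rewrite big1 ?addr0 // => k /negPf ki; apply: big1 => l _.
by rewrite mxE ki mulr0.
Qed.

Lemma frob_inner_ge0 X : 0 <= frob_inner X X.
Proof.
rewrite frob_innerE; apply: sumr_ge0 => i _; apply: sumr_ge0 => j _.
by rewrite -expr2 sqr_ge0.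
Qed.

Lemma frob_norm_ge0 X : 0 <= frob_norm X.
Proof. exact: sqrtr_ge0. Qed.

Lemma frob_norm_sqr X : frob_norm X ^+ 2 = frob_inner X X.
Proof. by rewrite sqr_sqrtr // frob_inner_ge0. Qed.

Lemma frob_normZ a X : frob_norm (a *: X) = `|a| * frob_norm X.
Proof.
rewrite /frob_norm frob_innerZl frob_innerZr mulrA -expr2 sqrtrM ?sqr_ge0 //.
by rewrite sqrtr_sqr.
Qed.

Lemma frob_normN X : frob_norm (- X) = frob_norm X.
Proof. by rewrite -scaleN1r frob_normZ normrN normr1 mul1r. Qed.

Lemma frob_distC X Y : frob_norm (X - Y) = frob_norm (Y - X).
Proof. by rewrite -frob_normN opprB. Qed.

Lemma normr_le_frob X i j : `|X i j| <= frob_norm X.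
Proof.
rewrite -sqrtr_sqr ler_wsqrtr // frob_innerE (bigD1 i) //= (bigD1 j) //=.
rewrite -expr2 -addrA lerDl addr_ge0 // ?sumr_ge0 // => k _.
  by rewrite -expr2 sqr_ge0.
by apply: sumr_ge0 => l _; rewrite -expr2 sqr_ge0.
Qed.

Lemma frob_norm0_eq0 X : frob_norm X = 0 -> X = 0.
Proof.
move=> X0; apply/matrixP => i j; rewrite mxE; apply/eqP.
by rewrite -normr_le0 -X0 normr_le_frob.
Qed.

Lemma frob_cauchy_schwarz X Y :
  `|frob_inner X Y| <= frob_norm X * frob_norm Y.
Proof.
have [Y0|Yn0] := eqVneq (frob_norm Y) 0.
  have -> := frob_norm0_eq0 Y0.
  by rewrite -[X in frob_inner _ X](scale0r X) frob_innerZr mul0r normr0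
    mulr_ge0 ?frob_norm_ge0.
have a_gt0 : 0 < frob_inner Y Y.
  by rewrite -frob_norm_sqr exprn_gt0 // lt_neqAle eq_sym Yn0 frob_norm_ge0.
rewrite -ler_sqr ?nnegrE ?mulr_ge0 ?frob_norm_ge0 // exprMn !frob_norm_sqr.
rewrite real_normK ?num_real //.
(* The squared norm of this matrix is [a * (a * c - s ^+ 2)] in the notation set below. *)
have := frob_inner_ge0 (frob_inner Y Y *: X - frob_inner X Y *: Y).
rewrite !(frob_innerBr, frob_innerBl, frob_innerZr, frob_innerZl).
rewrite (frob_innerC Y X); set a := frob_inner Y Y; set s := frob_inner X Y.
set c := frob_inner X X => h; rewrite -(ler_pM2l a_gt0) -/a -subr_ge0.
by apply: le_trans h _; rewrite le_eqVlt; apply/orP; left; apply/eqP; ring.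
Qed.

End Frobenius.

(** * Borel measurability on matrix spaces *)

Section BorelMatrices.
Variables (R : realType) (p q : nat).

Lemma continuous_borel_mx (f : 'M[R]_(p, q) -> R) :
  continuous f -> measurable_fun [set: borel_mx R p q] (f : borel_mx R p q -> R).
Proof.
move=> cf; apply: (measurability _ (RGenOInfty.measurableE R)).
move=> _ [_ [a ->] <-]; rewrite setTI; apply: sub_sigma_algebra.
by move: cf => /continuousP; apply; exact: itv_open_ends_open.
Qed.

Lemma continuous_entry (i : 'I_p) (j : 'I_q) :
  continuous (fun X : 'M[R]_(p, q) => X i j).
Proof. exact: coord_continuous. Qed.

Lemma measurable_entry (i : 'I_p) (j : 'I_q) :
  measurable_fun [set: borel_mx R p q] (fun X : borel_mx R p q => (X : 'M[R]_(p, q)) i j).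
Proof. by apply: continuous_borel_mx; exact: continuous_entry. Qed.

Lemma continuous_borel_borel p' q' (f : 'M[R]_(p, q) -> 'M[R]_(p', q')) :
  continuous f ->
  measurable_fun [set: borel_mx R p q] (f : borel_mx R p q -> borel_mx R p' q').
Proof.
move=> cf mD A mA; rewrite setTI.
pose C := [set B : set (borel_mx R p' q') |
  measurable (f @^-1` B : set (borel_mx R p q))].
suff : <<s @open 'M[R]_(p', q') >> `<=` C by apply.
apply: smallest_sub.
- rewrite /C; split => /=.
  + by rewrite preimage_set0; exact: measurable0.
  + by move=> B mB; rewrite setTD preimage_setC; exact: measurableC.
  + by move=> B mB; rewrite preimage_bigcup; exact: bigcupT_measurable.
- move=> B oB /=; apply: sub_sigma_algebra.
  by move: cf => /continuousP; apply.
Qed.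

Lemma measurable_translate (Z : 'M[R]_(p, q)) :
  measurable_fun [set: borel_mx R p q]
    (fun X : borel_mx R p q => (X : 'M[R]_(p, q)) + Z : borel_mx R p q).
Proof.
apply: (@continuous_borel_borel _ _ (fun X => X + Z)) => X.
apply: (@continuousD _ _ _ (fun X => X) (fun=> Z)); first exact: cvg_id.
exact: cst_continuous.
Qed.

Lemma measurable_frob_inner d (T : measurableType d)
    (X Y : T -> 'M[R]_(p, q)) :
  (forall i j, measurable_fun setT (fun w => X w i j)) ->
  (forall i j, measurable_fun setT (fun w => Y w i j)) ->
  measurable_fun setT (fun w => frob_inner (X w) (Y w)).
Proof.
move=> mX mY; under eq_fun do rewrite frob_innerE.
apply: measurable_sum => i; apply: measurable_sum => j.
exact: measurable_funM.
Qed.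

End BorelMatrices.

(** * Measurability with respect to a sub-sigma-algebra *)

Section SubSigmaAlgebra.
Context (R : realType) (d : measure_display) (T : measurableType d).
Variables (P : probability T R) (F : set (set T)).
Hypotheses (sF : sigma_algebra [set: T] F) (Fm : F `<=` measurable).

(** Giving the sample space the sigma-algebra [F] as its measurable structure makes the closure
    properties of [measurable_fun] available for [measurable_wrt]. *)
Lemma measurable_wrtP d' (U : measurableType d') (X : T -> U) :
  measurable_wrt F X <->
  measurable_fun [set: g_sigma_algebraType F] (X : g_sigma_algebraType F -> U).
Proof.
have FE : @measurable _ (g_sigma_algebraType F) = F by exact: sigma_algebra_id.
split=> [mX _ A mA|mX A mA]; first by rewrite setTI FE; exact: mX.
by rewrite -FE -[_ @^-1` _]setTI; exact: mX.
Qed.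

Lemma measurable_wrt_fun d' (U : measurableType d') (X : T -> U) :
  measurable_wrt F X -> measurable_fun setT X.
Proof. by move=> mX _ A mA; rewrite setTI; exact/Fm/mX. Qed.

End SubSigmaAlgebra.

(** * Integrals of bounded functions under a probability *)

Section BoundedIntegrals.
Context (R : realType) (d : measure_display) (T : measurableType d).
Variable P : probability T R.
Implicit Types (D : set T) (W X Y h : T -> R).

Lemma integrable_mul_bounded D W h c : measurable D ->
  measurable_fun D W -> (forall x, D x -> `|W x| <= c) ->
  P.-integrable D (EFin \o h) ->
  P.-integrable D (EFin \o (fun x => W x * h x)).
Proof.
move=> mD mW Wc ih.
have -> : EFin \o (fun x => W x * h x) = ((EFin \o W) \* (EFin \o h))%E.
  by apply/funext => x /=; rewrite EFinM.
apply: integrableMr => //; exists c; split; first exact: num_real.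
by move=> M cM x Dx; apply: le_trans (Wc _ Dx) (ltW cM).
Qed.

Lemma integrable_bounded D W c : measurable D ->
  measurable_fun D W -> (forall x, D x -> `|W x| <= c) ->
  P.-integrable D (EFin \o W).
Proof.
move=> mD mW Wc; apply: measurable_bounded_integrable => //.
  by rewrite (le_lt_trans (probability_le1 P mD)) ?ltry.
exists c; split; first exact: num_real.
by move=> M cM x Dx; apply: le_trans (Wc _ Dx) (ltW cM).
Qed.

Lemma integrable_sub D X Y : measurable D ->
  P.-integrable D (EFin \o X) -> P.-integrable D (EFin \o Y) ->
  P.-integrable D (EFin \o (fun x => X x - Y x)).
Proof.
move=> mD iX iY.
have -> : EFin \o (fun x => X x - Y x) = ((EFin \o X) \- (EFin \o Y))%E.
  by apply/funext => x /=; rewrite EFinB.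
exact: integrableB.
Qed.

Lemma integrable_add D X Y : measurable D ->
  P.-integrable D (EFin \o X) -> P.-integrable D (EFin \o Y) ->
  P.-integrable D (EFin \o (fun x => X x + Y x)).
Proof.
move=> mD iX iY.
have -> : EFin \o (fun x => X x + Y x) = ((EFin \o X) \+ (EFin \o Y))%E.
  by apply/funext => x /=; rewrite EFinD.
exact: integrableD.
Qed.

Lemma Rintegral_indicM D A h : measurable A ->
  (\int[P]_(x in D) (\1_A x * h x) = \int[P]_(x in D `&` A) h x)%R.
Proof.
move=> mA; rewrite Rintegral_mkcondr; apply: eq_Rintegral => x _.
by rewrite patchE indicE; case: (x \in A); rewrite ?mul1r ?mul0r.
Qed.

Lemma Rintegral_1 : (\int[P]_x 1 = 1 :> R)%R.
Proof.
rewrite Rintegral_cst // mul1r -[RHS]/(fine 1%E); congr fine.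
exact: probability_setT.
Qed.

End BoundedIntegrals.

(** * Pulling a measurable factor out of a local conditional expectation *)

Section PullOut.
Context (R : realType) (d : measure_display) (T : measurableType d).
Variables (P : probability T R) (F : set (set T)).
Hypotheses (sF : sigma_algebra [set: T] F) (Fm : F `<=` measurable).
Variable S : set T.
Hypothesis FS : F S.

(** The sum is the integer part of [y], written with thresholds so that it becomes a simple function
    once [y] depends on a point. *)
Lemma sum_threshold_le (y : R) (J : nat) : 0 <= y -> y <= J%:R ->
  `|y - \sum_(j < J) ((j.+1)%:R <= y)%R%:R| <= 1.
Proof.
move=> y0; elim: J => [|J IH] yJ.
  have -> : y = 0 by apply/eqP; rewrite eq_le y0 yJ.
  by rewrite big_ord0 subr0 normr0.
rewrite big_ord_recr /=; have [yJ'|Jy] := leP y J%:R.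
  rewrite [(_ <= y)](_ : _ = false) ?addr0; first exact: IH.
  by apply/negbTE; rewrite -ltNge (le_lt_trans yJ') // ltr_nat.
have -> : \sum_(i < J) ((i.+1)%:R <= y)%R%:R = J%:R :> R.
  rewrite (eq_bigr (fun=> 1)) ?sumr_const ?card_ord // => i _.
  by rewrite (le_trans _ (ltW Jy)) // ler_nat.
have J1 : J.+1%:R = J%:R + 1 :> R by rewrite -natr1.
rewrite J1 in yJ *; have [h|h] := leP (J%:R + 1) y.
  by rewrite (_ : y = J%:R + 1) ?h ?subrr ?normr0 //; apply/eqP; rewrite eq_le yJ h.
by rewrite addr0 ger0_norm ?subr_ge0 ?(ltW Jy) // lerBlDr addrC ltW.
Qed.

(* [W] is approximated within [1/k] by the nonnegative combination
   [k^-1 * \sum_(j < J) \1_(j+1 <= k W)] of indicators of sets of [F]. *)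
Lemma Rintegral_eq0_mul (h W : T -> R) (c : R) :
  P.-integrable S (EFin \o h) ->
  (forall E, F E -> E `<=` S -> (\int[P]_(x in E) h x = 0)%R) ->
  measurable_wrt F W -> (forall x, S x -> 0 <= W x <= c) ->
  (\int[P]_(x in S) (W x * h x) = 0)%R.
Proof.
move=> ih h0 mW Wc; have mS := Fm FS.
have mWS : measurable_fun S W.
  exact/measurable_funTS/(measurable_wrt_fun Fm).
have iWh : P.-integrable S (EFin \o (fun x => W x * h x)).
  apply: (integrable_mul_bounded (c := c)) => // x /Wc /andP[w0 wc].
  by rewrite ger0_norm.
pose H := (\int[P]_(x in S) `|h x|)%R.
have H0 : 0 <= H by apply: Rintegral_ge0.
suff key k : (0 < k)%N -> `|\int[P]_(x in S) (W x * h x)|%R <= k%:R^-1 * H.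
  apply/eqP; rewrite -normr_le0; apply/ler_addgt0Pr => e e0; rewrite add0r.
  pose k := (Num.bound (H / e)).+1.
  apply: le_trans (key k isT) _.
  rewrite mulrC ler_pdivrMr ?ltr0n // mulrC -ler_pdivrMr //.
  apply: le_trans (ltW (archi_boundP (divr_ge0 H0 (ltW e0)))) _.
  by rewrite ler_nat.
move=> k0.
pose A j := [set x | (j.+1)%:R <= k%:R * W x].
have FA j : F (A j).
  have := mW `[j.+1%:R / k%:R, +oo[%classic (measurable_itv _).
  congr F; apply/seteqP; split => x; rewrite /A /= in_itv /= andbT.
    by rewrite ler_pdivrMr ?ltr0n // mulrC.
  by rewrite ler_pdivrMr ?ltr0n // mulrC.
pose g J x := \sum_(j < J) \1_(A j) x : R.
have mg J : measurable_fun S (g J).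
  by apply: measurable_sum => j; apply: measurable_indic; exact: Fm.
have gJ J x : `|g J x| <= J%:R.
  apply: le_trans (ler_norm_sum _ _ _) _.
  rewrite -[X in _ <= X%:R](card_ord J) -sum1_card natr_sum.
  apply: ler_sum => j _.
  by rewrite indicE; case: (_ \in _); rewrite ?normr1 ?normr0.
have ig J : P.-integrable S (EFin \o (fun x => g J x * h x)).
  by apply: (integrable_mul_bounded (c := J%:R)).
have g0 J : (\int[P]_(x in S) (g J x * h x) = 0)%R.
  elim: J => [|J IH].
    rewrite (@eq_Rintegral _ _ _ _ _ (fun=> 0)) ?Rintegral_cst ?mul0r //.
    by move=> x _; rewrite /g big_ord0 mul0r.
  rewrite (@eq_Rintegral _ _ _ _ _ (fun x => g J x * h x + \1_(A J) x * h x)).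
    rewrite RintegralD //.
      rewrite IH add0r Rintegral_indicM; last exact/Fm/FA.
      apply: h0; last by move=> x [].
      have := @sigma_algebra_id _ _ _ sF; move=> <-.
      by apply: (@measurableI _ (g_sigma_algebraType F));
        apply: sub_sigma_algebra.
    apply: (integrable_mul_bounded (c := 1)) => //.
      exact/measurable_indic/Fm/FA.
    by move=> x _; rewrite indicE; case: (_ \in _); rewrite ?normr1 ?normr0.
  by move=> x _; rewrite /g big_ord_recr /= mulrDl.
pose J := Num.bound (k%:R * c).
have WgJ x : S x -> `|W x - k%:R^-1 * g J x| <= k%:R^-1.
  move=> /Wc /andP[w0 wc].
  have kc : k%:R * W x <= J%:R.
    apply: le_trans (ler_wpM2l (ler0n _ _) wc) _.
    apply/ltW/archi_boundP; rewrite mulr_ge0 //; exact: le_trans wc.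
  have := sum_threshold_le (mulr_ge0 (ler0n _ k) w0) kc.
  have -> : \sum_(j < J) ((j.+1)%:R <= k%:R * W x)%R%:R = g J x.
    apply: eq_bigr => j _; rewrite indicE; congr (nat_of_bool _)%:R.
    by apply/idP/idP; rewrite inE.
  have -> : W x - k%:R^-1 * g J x = k%:R^-1 * (k%:R * W x - g J x).
    by rewrite mulrBr mulKf // pnatr_eq0 -lt0n.
  rewrite normrM ger0_norm ?invr_ge0 // => /ler_wpM2l h1.
  by apply: le_trans (h1 _ _) _; rewrite ?mulr1 ?invr_ge0.
(* Subtracting the simple function costs nothing, because its product with [h] integrates to 0; the
   remaining factor is at most [k^-1] in absolute value. *)
have -> : (\int[P]_(x in S) (W x * h x) =
    \int[P]_(x in S) ((W x - k%:R^-1 * g J x) * h x))%R.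
  rewrite [RHS](@eq_Rintegral _ _ _ _ _
    (fun x => W x * h x - k%:R^-1 * (g J x * h x))); last first.
    by move=> x _; rewrite mulrBl mulrA.
  have ikg : P.-integrable S (EFin \o (fun x => k%:R^-1 * (g J x * h x))).
    apply: (integrable_mul_bounded (c := k%:R^-1)) => //.
    by move=> x _; rewrite ger0_norm ?invr_ge0.
  by rewrite RintegralB // RintegralZl // g0 mulr0 subr0.
have ikh : P.-integrable S (EFin \o (fun x => k%:R^-1 * `|h x|)).
  apply: (integrable_mul_bounded (c := k%:R^-1)) => //; last exact: integrable_norm.
  by move=> x _; rewrite ger0_norm ?invr_ge0.
have iWgh : P.-integrable S (EFin \o (fun x => (W x - k%:R^-1 * g J x) * h x)).
  apply: (integrable_mul_bounded (c := k%:R^-1)) => //.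
  by apply: measurable_funB => //; apply: measurable_funM.
apply: le_trans (le_normr_Rintegral mS iWgh) _.
rewrite -RintegralZl //; last exact: integrable_norm.
apply: le_Rintegral => //; first exact: integrable_norm.
by move=> x Sx; rewrite normrM ler_wpM2r // WgJ.
Qed.

Lemma condexp_on_pullout (X Y W : T -> R) (c : R) : condexp_on P F S X Y ->
  measurable_wrt F W -> (forall x, S x -> `|W x| <= c) ->
  (\int[P]_(x in S) (W x * X x) = \int[P]_(x in S) (W x * Y x))%R.
Proof.
move=> [mY iX iY XY] mW Wc; have mS := Fm FS.
have mWS : measurable_fun S W.
  exact/measurable_funTS/(measurable_wrt_fun Fm).
pose h x := X x - Y x.
have ih : P.-integrable S (EFin \o h).
  exact: (integrable_sub mS iX iY).
have h0 E : F E -> E `<=` S -> (\int[P]_(x in E) h x = 0)%R.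
  move=> FE ES; have mE := Fm FE.
  rewrite RintegralB //; [|exact: integrableS iX|exact: integrableS iY].
  by rewrite /Rintegral XY // subrr.
have iW Z : P.-integrable S (EFin \o Z) ->
    P.-integrable S (EFin \o (fun x => W x * Z x)).
  exact: integrable_mul_bounded mS mWS Wc.
apply/eqP; rewrite -subr_eq0 -RintegralB //; [apply/eqP|exact: iW|exact: iW].
(* The shift by [c] makes the weight nonnegative, as [Rintegral_eq0_mul] requires; it adds [c] times
   the integral of [h] over [S], which is 0. *)
pose W' x := W x + c.
pose u x := W x * X x - W x * Y x.
have iu : P.-integrable S (EFin \o u).
  exact: (integrable_sub mS (iW _ iX) (iW _ iY)).
have <- : (\int[P]_(x in S) (W' x * h x) = 0)%R.
  apply: (@Rintegral_eq0_mul _ _ (c + c)) => //.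
    apply/(measurable_wrtP sF) ; apply: measurable_funD => //.
    exact/(measurable_wrtP sF).
  by move=> x /Wc; rewrite /W' ler_norml => /andP[]; lra.
have ich : P.-integrable S (EFin \o (fun x => c * h x)).
  exact: (integrable_mul_bounded (c := `|c|)).
transitivity (\int[P]_(x in S) (u x + c * h x))%R.
  by rewrite (RintegralD mS iu ich) RintegralZl // h0 // mulr0 addr0.
by apply: eq_Rintegral => x _; rewrite /W' /h /u; ring.
Qed.

End PullOut.

Lemma expR_le_id_expR_sqr (R : realType) (x : R) : expR x <= x + expR (2 * x ^+ 2).
Proof.
have [x2|x2] := leP x (2^-1).
  have x1 : 0 < 1 - x by lra.
  have h1 : expR x <= (1 - x)^-1.
    rewrite -[x]opprK expRN opprK lef_pV2 ?posrE ?expR_gt0 //.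
    exact: expR_ge1Dx.
  have h2 : (1 - x)^-1 <= 1 + x + 2 * x ^+ 2.
    rewrite -[leLHS]mul1r ler_pdivrMr // -subr_ge0.
    have -> : (1 + x + 2 * x ^+ 2) * (1 - x) - 1 = x ^+ 2 * (1 - 2 * x) by ring.
    by rewrite mulr_ge0 ?sqr_ge0 //; lra.
  have := expR_ge1Dx (2 * x ^+ 2); lra.
rewrite ler_wpDl //; first lra.
rewrite ler_expR; nra.
Qed.

(** * Exponential moments and a Chernoff bound for biased bounded noise *)

Section Supermartingale.
Context (R : realType) (d : measure_display) (T : measurableType d).
Variable P : probability T R.

(** [X] stands for the exponential of the past noise, and the last hypothesis is a conditional mean
    bound on [z] tested against this single weight. The exponential inequality gives the factor
    [lam * e + E2], which is at most [E2 * (1 + lam * e)] because [E2 >= 1]. *)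
Lemma mgf_step (X z : T -> R) (c e Cx lam : R) :
  measurable_fun setT X -> (forall w, 0 <= X w <= Cx) ->
  measurable_fun setT z -> (forall w, `|z w| <= c) -> 0 <= lam -> 0 <= e ->
  (\int[P]_w (X w * z w) <= e * \int[P]_w X w)%R ->
  (\int[P]_w (X w * expR (lam * z w))
     <= expR (2 * lam ^+ 2 * c ^+ 2 + lam * e) * \int[P]_w X w)%R.
Proof.
move=> mX X01 mz zc lam0 e0 Xz.
have XCx w : setT w -> `|X w| <= Cx.
  by move=> _; have /andP[x0 x1] := X01 w; rewrite ger0_norm.
have iX : P.-integrable setT (EFin \o X) by exact: integrable_bounded XCx.
have iz : P.-integrable setT (EFin \o z).
  by apply: (@integrable_bounded _ _ _ _ _ _ c) => // w _.
have iXz : P.-integrable setT (EFin \o (fun w => X w * z w)).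
  exact: integrable_mul_bounded XCx iz.
have c0 : 0 <= c := le_trans (normr_ge0 (z point)) (zc point).
have zc2 w : z w ^+ 2 <= c ^+ 2.
  rewrite -[z w ^+ 2]real_normK ?num_real // ler_sqr ?nnegrE ?normr_ge0 //.
pose E2 := expR (2 * lam ^+ 2 * c ^+ 2).
have pw w : X w * expR (lam * z w) <= lam * (X w * z w) + E2 * X w.
  have /andP[x0 _] := X01 w.
  rewrite (_ : _ + _ = X w * (lam * z w + E2)); last by ring.
  apply: ler_wpM2l => //; apply: le_trans (expR_le_id_expR_sqr _) _.
  rewrite lerD2l ler_expR exprMn mulrA ler_wpM2l // mulr_ge0 ?sqr_ge0 //.
have ie : P.-integrable setT (EFin \o (fun w => expR (lam * z w))).
  apply: (@integrable_bounded _ _ _ _ _ _ (expR (lam * c))) => //.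
    apply: measurableT_comp => //; exact: measurable_funM.
  move=> w _; rewrite ger0_norm ?expR_ge0 // ler_expR ler_wpM2l //.
  exact: le_trans (ler_norm _) (zc w).
have iXe : P.-integrable setT (EFin \o (fun w => X w * expR (lam * z w))).
  exact: integrable_mul_bounded XCx ie.
have icm a Z : P.-integrable setT (EFin \o Z) ->
    P.-integrable setT (EFin \o (fun w => a * Z w)).
  by move=> iZ; apply: (integrable_mul_bounded (c := `|a|)).
have EX0 : 0 <= (\int[P]_w X w)%R.
  by apply: Rintegral_ge0 => w _; have /andP[] := X01 w.
have h1 : (\int[P]_w (X w * expR (lam * z w)) <=
    \int[P]_w (lam * (X w * z w) + E2 * X w))%R.
  apply: le_Rintegral => //.
  exact: (integrable_add measurableT (icm lam _ iXz) (icm E2 _ iX)).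
apply: le_trans h1 _.
rewrite (RintegralD measurableT (icm _ _ iXz) (icm _ _ iX)) !RintegralZl //.
have h2 : lam * (\int[P]_w (X w * z w))%R <= lam * e * (\int[P]_w X w)%R.
  by rewrite -mulrA ler_wpM2l.
apply: le_trans (lerD h2 (lexx _)) _; rewrite -mulrDl ler_wpM2r //.
rewrite expRD -/E2.
have E21 : 1 <= E2.
  by rewrite /E2 -expR0 ler_expR !mulr_ge0 ?sqr_ge0.
have E20 : 0 <= E2 by exact: expR_ge0.
apply: le_trans (ler_wpM2l E20 (expR_ge1Dx (lam * e))).
by rewrite mulrDr mulr1 addrC lerD2l ler_peMl // mulr_ge0.
Qed.

Variable F : nat -> set (set T).
Hypothesis hF : filtration F.

Lemma measurable_wrt_le s t d' (U : measurableType d') (X : T -> U) :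
  (s <= t)%N -> measurable_wrt (F s) X -> measurable_wrt (F t) X.
Proof.
move=> st mX V mV; elim: t st => [|t IH].
  by rewrite leqn0 => /eqP <-; exact: mX.
rewrite leq_eqVlt => /predU1P[<-|]; first exact: mX.
by rewrite ltnS => /IH; case: hF => _ _; apply.
Qed.

Variables (z : nat -> T -> R) (c e : nat -> R).
Hypothesis mz : forall t, measurable_wrt (F t.+1) (z t).
Hypothesis zc : forall t w, `|z t w| <= c t.
Hypothesis e0 : forall t, 0 <= e t.
(** The integrated form of a conditional mean at most [e t], which spares the choice of a version of
    the conditional expectation of [z t]. *)
Hypothesis ze : forall t (X : T -> R) (Cx : R), measurable_wrt (F t) X ->
  (forall w, 0 <= X w <= Cx) ->
  (\int[P]_w (X w * z t w) <= e t * \int[P]_w X w)%R.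

Lemma measurable_wrt_partial_sum t :
  measurable_wrt (F t) (fun w => \sum_(s < t) z s w).
Proof.
have [sF _ _] := hF; apply/(measurable_wrtP (sF t)).
apply: measurable_sum => s; apply/(measurable_wrtP (sF t)).
exact: measurable_wrt_le (ltn_ord s) (mz s).
Qed.

Lemma mgf_partial_sum (lam : R) t : 0 <= lam ->
  (\int[P]_w expR (lam * \sum_(s < t) z s w)
     <= expR (\sum_(s < t) (2 * lam ^+ 2 * c s ^+ 2 + lam * e s)))%R.
Proof.
have [sF Fm _] := hF.
move=> lam0; elim: t => [|t IH].
  rewrite (@eq_Rintegral _ _ _ _ _ (fun=> 1)).
    by rewrite Rintegral_1 big_ord0 expR0.
  by move=> w _; rewrite big_ord0 mulr0 expR0.
rewrite (@eq_Rintegral _ _ _ _ _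
  (fun w => expR (lam * \sum_(s < t) z s w) * expR (lam * z t w))); last first.
  by move=> w _; rewrite big_ord_recr /= mulrDr expRD.
pose X w := expR (lam * \sum_(s < t) z s w).
have mX : measurable_wrt (F t) X.
  apply/(measurable_wrtP (sF t)); apply: measurableT_comp => //.
  apply: measurable_funM => //; apply/(measurable_wrtP (sF t)).
  exact: measurable_wrt_partial_sum.
have X01 w : 0 <= X w <= expR (lam * \sum_(s < t) c s).
  rewrite expR_ge0 ler_expR ler_wpM2l //; apply: ler_sum => s _.
  exact: le_trans (ler_norm _) (zc _ _).
have mXt : measurable_fun setT X by exact (measurable_wrt_fun (Fm t) mX).
have mzt : measurable_fun setT (z t) by exact (measurable_wrt_fun (Fm t.+1) (mz t)).
apply: le_trans (mgf_step mXt X01 mzt (zc t) lam0 (e0 t) (ze mX X01)) _.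
by rewrite big_ord_recr /= [leRHS]expRD [leRHS]mulrC ler_wpM2l ?expR_ge0.
Qed.

(** Markov's inequality for the exponential of [lam] times the sum: the threshold is the one whose
    exponential is the moment bound divided by [dl]. The parameter [lam] stays free, to be tuned to
    the horizon. *)
Lemma chernoff_partial_sum (lam dl : R) t : 0 < lam -> 0 < dl ->
  (P [set w | (\sum_(s < t) e s + 2 * lam * (\sum_(s < t) c s ^+ 2)
          + ln (1 / dl) / lam <= \sum_(s < t) z s w)%R] <= dl%:E)%E.
Proof.
have [sF Fm _] := hF.
move=> lam0 dl0; set a := _ + ln _ / lam; set A := [set w | _].
have mS : measurable_fun setT (fun w => \sum_(s < t) z s w).
  exact (measurable_wrt_fun (Fm t) (measurable_wrt_partial_sum t)).
have mA : measurable A.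
  rewrite (_ : A = setT `&` (fun w => \sum_(s < t) z s w) @^-1` `[a, +oo[%classic).
    exact: mS.
  by rewrite setTI; apply/seteqP; split => w; rewrite /A /= in_itv /= andbT.
pose f w := expR (lam * \sum_(s < t) z s w).
pose B := expR (\sum_(s < t) (2 * lam ^+ 2 * c s ^+ 2 + lam * e s)).
have la : expR (lam * a) = B / dl.
  rewrite /a !mulrDr [lam * (_ / lam)]mulrC divfK ?gt_eqF // expRD div1r.
  rewrite lnK ?posrE ?invr_gt0 //; congr (expR _ / _).
  rewrite big_split /= -!mulr_sumr addrC; congr (_ + _).
  by rewrite mulrA expr2 mulrCA !mulrA.
have mf : measurable_fun setT f.
  by apply: measurableT_comp => //; exact: measurable_funM.
have iff : P.-integrable setT (EFin \o f).
  apply: (@integrable_bounded _ _ _ _ _ _ (expR (lam * \sum_(s < t) c s))) => //.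
  move=> w _; rewrite ger0_norm ?expR_ge0 // ler_expR ler_pM2l //.
  by apply: ler_sum => s _; exact: le_trans (ler_norm _) (zc _ _).
have i1 : P.-integrable setT (EFin \o (\1_A : T -> R)).
  apply: (@integrable_bounded _ _ _ _ _ _ 1) => //.
  by move=> w _; rewrite indicE; case: (_ \in _); rewrite ?normr1 ?normr0.
rewrite -(@fineK _ (P A)) ?fin_num_measure // lee_fin.
have PA : (\int[P]_w \1_A w)%R = fine (P A).
  by rewrite /Rintegral integral_indic // setIT.
have Bd : 0 < B / dl by rewrite divr_gt0 ?expR_gt0.
rewrite -(ler_pM2l Bd) divfK ?gt_eqF //.
apply: le_trans (mgf_partial_sum t (ltW lam0)).
rewrite -la -PA -RintegralZl //.
apply: le_Rintegral => //.
  by apply: (integrable_mul_bounded (c := `|expR (lam * a)|)).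
move=> w _; rewrite indicE; case: (boolP (w \in A)) => [|_].
  by rewrite inE /A /= mulr1 ler_expR ler_pM2l.
by rewrite mulr0 expR_ge0.
Qed.

End Supermartingale.

(** * Summability of the powers of a matrix of spectral radius below 1 *)

Section PowerSummability.
Variable R : realType.
Local Notation C := R[i].
Local Notation normc := ComplexField.Normc.normc.

(** The triangle inequality and homogeneity are all that the recurrence needs; the entrywise sum is
    the norm that reduces to absolute values of entries on real matrices. *)
Definition norm1 n (X : 'M[C]_n) : R := \sum_i \sum_j normc (X i j).

Lemma normc_ge0 (x : C) : 0 <= normc x.
Proof. by case: x => a b; exact: sqrtr_ge0. Qed.

Lemma normc_real (x : R) : normc (real_complex R x) = `|x|.
Proof. by rewrite /= expr0n addr0 sqrtr_sqr. Qed.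

Lemma norm1_ge0 n (X : 'M[C]_n) : 0 <= norm1 X.
Proof. by apply: sumr_ge0 => i _; apply: sumr_ge0 => j _; exact: normc_ge0. Qed.

Lemma norm1D n (X Y : 'M[C]_n) : norm1 (X + Y) <= norm1 X + norm1 Y.
Proof.
rewrite /norm1 -big_split; apply: ler_sum => i _ /=.
rewrite -big_split; apply: ler_sum => j _ /=; rewrite mxE.
exact: le_normcD.
Qed.

Lemma norm1Z n a (X : 'M[C]_n) : norm1 (a *: X) = normc a * norm1 X.
Proof.
rewrite /norm1 mulr_sumr; apply: eq_bigr => i _; rewrite mulr_sumr.
by apply: eq_bigr => j _; rewrite mxE ComplexField.Normc.normcM.
Qed.

(* If [u (i+1) = l u i + w i] with [|l| < 1] and [w] summable, then [u] is
   summable; one such recurrence is peeled off for each factor [X - l] of the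
   characteristic polynomial, which annihilates the matrix. *)
Lemma summable_powers_horner n (M : 'M[C]_n.+1) (rs : seq C) (q : {poly C}) :
  (forall r, r \in rs -> normc r < 1) ->
  (exists B, forall N, \sum_(i < N)
     norm1 (M ^+ i * horner_mx M (q * \prod_(r <- rs) ('X - r%:P))) <= B) ->
  exists B, forall N, \sum_(i < N) norm1 (M ^+ i * horner_mx M q) <= B.
Proof.
elim: rs q => [|l rs IH] q lt1.
  by rewrite big_nil mulr1.
rewrite big_cons mulrA => hB.
have [|B hBq] := IH (q * ('X - l%:P)) _ hB.
  by move=> r rrs; apply: lt1; rewrite in_cons rrs orbT.
have l1 : normc l < 1 by apply: lt1; rewrite mem_head.
pose u i := norm1 (M ^+ i * horner_mx M q).
have step i : u i.+1 <= normc l * u i +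
    norm1 (M ^+ i * horner_mx M (q * ('X - l%:P))).
  rewrite /u -norm1Z; apply: le_trans (norm1D _ _).
  rewrite le_eqVlt; apply/orP; left; apply/eqP; congr norm1.
  rewrite [q * _]mulrC rmorphM rmorphB /= horner_mx_X horner_mx_C exprSr.
  rewrite mulrBl mulrBr mulrA -[l%:M * _]/(l%:M *m _) mul_scalar_mx scalerAr.
  by rewrite addrC subrK.
exists ((u 0%N + B) / (1 - normc l)) => N.
rewrite ler_pdivlMr ?subr_gt0 //.
suff : \sum_(i < N) u i <= u 0%N + normc l * \sum_(i < N) u i + B by lra.
case: N => [|N].
  rewrite !big_ord0 mulr0 addr0; have := hBq 0%N; rewrite big_ord0.
  by have := norm1_ge0 (M ^+ 0 * horner_mx M q); rewrite /u; lra.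
rewrite [leLHS]big_ord_recl /= -addrA lerD2l.
apply: (@le_trans _ _ (\sum_(i < N) (normc l * u i +
    norm1 (M ^+ i * horner_mx M (q * ('X - l%:P)))))).
  by apply: ler_sum => i _; exact: step.
rewrite big_split /=; apply: lerD; last exact: hBq.
rewrite -mulr_sumr ler_wpM2l ?normc_ge0 //.
by rewrite [leRHS]big_ord_recr /= lerDl norm1_ge0.
Qed.

Lemma summable_powers n (A : 'M[R]_n) : spectral_radius A < 1 ->
  exists B, forall N, \sum_(i < N) \sum_j \sum_k `|(A ^+ i) j k| <= B.
Proof.
case: n A => [|n] A rho1.
  by exists 0 => N; rewrite big1 // => i _; rewrite big_ord0.
pose M := map_mx (real_complex R) A.
have [rs] := closed_field_poly_normal (char_poly M).
have /monicP -> := char_poly_monic M; rewrite scale1r => charE.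
have rsE l : (l \in rs) = eigenvalue M l.
  by rewrite eigenvalue_root_char charE root_prod_XsubC.
have lt1 l : l \in rs -> normc l < 1.
  rewrite rsE => el; apply: le_lt_trans rho1; apply: ub_le_sup; last first.
    by exists l.
  (* The supremum dominates each modulus only if the moduli are bounded; their sum over the roots is
     a bound. *)
  exists (\sum_(r <- rs) normc r) => _ [r /= er <-].
  move: er; rewrite -rsE => rrs; rewrite (big_rem r) //= lerDl.
  by apply: sumr_ge0 => *; exact: normc_ge0.
(* For [q = 1] the full product is the characteristic polynomial, so by Cayley-Hamilton the required
   bound is 0. *)
have [|B hB] := @summable_powers_horner n M rs 1 lt1.
  exists 0 => N; rewrite big1 // => i _.
  rewrite mul1r -charE Cayley_Hamilton mulr0 /norm1 big1 // => j _.
  by rewrite big1 // => k _; rewrite mxE ComplexField.Normc.normc0.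
exists B => N; apply: le_trans (hB N).
rewrite le_eqVlt; apply/orP; left; apply/eqP.
apply: eq_bigr => i _; apply: eq_bigr => j _; apply: eq_bigr => k _.
by rewrite rmorph1 mulr1 -[M ^+ i](rmorphXn (map_mx _)) mxE normc_real.
Qed.

End PowerSummability.

(** * Entrywise measurability of matrix-valued functions *)

Section MatrixMeasurability.
Context (R : realType) (d : measure_display) (T : measurableType d).

(** Entrywise, so that matrix operations reduce to sums and products of real measurable
    functions. *)
Definition measurable_mx p q (X : T -> 'M[R]_(p, q)) :=
  forall i j, measurable_fun setT (fun w => X w i j).

Lemma measurable_mx_cst p q (X : 'M[R]_(p, q)) : measurable_mx (fun=> X).
Proof. by move=> i j; exact: measurable_cst. Qed.

Lemma measurable_mxD p q (X Y : T -> 'M[R]_(p, q)) :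
  measurable_mx X -> measurable_mx Y -> measurable_mx (fun w => X w + Y w).
Proof.
move=> mX mY i j; under eq_fun do rewrite mxE.
exact: measurable_funD.
Qed.

Lemma measurable_mxB p q (X Y : T -> 'M[R]_(p, q)) :
  measurable_mx X -> measurable_mx Y -> measurable_mx (fun w => X w - Y w).
Proof.
move=> mX mY i j; under eq_fun do rewrite !mxE.
exact: measurable_funB.
Qed.

Lemma measurable_mulmx p q r (X : T -> 'M[R]_(p, q)) (Y : T -> 'M[R]_(q, r)) :
  measurable_mx X -> measurable_mx Y -> measurable_mx (fun w => X w *m Y w).
Proof.
move=> mX mY i j; under eq_fun do rewrite mxE.
by apply: measurable_sum => k; exact: measurable_funM.
Qed.

Lemma measurable_trmx p q (X : T -> 'M[R]_(p, q)) :
  measurable_mx X -> measurable_mx (fun w => (X w)^T).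
Proof. by move=> mX i j; under eq_fun do rewrite mxE; exact: (mX j i). Qed.

Lemma measurable_mxX p (X : T -> 'M[R]_p) k :
  measurable_mx X -> measurable_mx (fun w => X w ^+ k).
Proof.
move=> mX; elim: k => [|k IH]; first exact: measurable_mx_cst.
rewrite (_ : (fun w => _) = fun w => X w *m X w ^+ k); first exact: measurable_mulmx.
by apply/funext => w; rewrite exprS.
Qed.

Lemma measurable_mxtrace p (X : T -> 'M[R]_p) :
  measurable_mx X -> measurable_fun setT (fun w => \tr (X w)).
Proof. by move=> mX; rewrite /mxtrace; apply: measurable_sum => i; exact: (mX i i). Qed.

End MatrixMeasurability.

(** * Quadratic forms of an isotropic random vector *)

Section QuadraticForm.
Variables (R : realType) (n : nat).
Implicit Types (W : 'M[R]_n) (x : 'cV[R]_n).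

Lemma quad_formE W x : quad_form W x = \sum_i \sum_j W i j * (x i 0 * x j 0).
Proof.
rewrite /quad_form mxE exchange_big; apply: eq_bigr => j _ /=.
rewrite mxE mulr_suml; apply: eq_bigr => i _.
by rewrite mxE mulrA mulrAC [_ * x j 0]mulrC [_ * x i 0]mulrC; ring.
Qed.

Lemma quad_form_ge0 W x : sym_posdef W -> 0 <= quad_form W x.
Proof.
move=> [_ W0]; have [->|/W0/ltW //] := eqVneq x 0.
by rewrite /quad_form mulmx0 mxE.
Qed.

Lemma quad_form_mulmx p (W : 'M[R]_p) (Y : 'M[R]_(p, n)) x :
  quad_form W (Y *m x) = quad_form (Y^T *m W *m Y) x.
Proof. by rewrite /quad_form trmx_mul !mulmxA. Qed.

Lemma quad_formN W x : quad_form W (- x) = quad_form W x.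
Proof. by rewrite /quad_form (raddfN trmx) !mulNmx mulmxN opprK. Qed.

Lemma quad_formD W1 W2 x :
  quad_form (W1 + W2) x = quad_form W1 x + quad_form W2 x.
Proof. by rewrite /quad_form mulmxDr mulmxDl mxE. Qed.

Variable D : probability (borel_mx R n 1) R.
Hypothesis hD : forall i j : 'I_n,
  (\int[D]_x ((x : 'cV[R]_n) i 0 * (x : 'cV[R]_n) j 0)%:E
   = ((1%:M : 'M[R]_n) i j)%:E)%E.

Lemma measurable_coordM (i j : 'I_n) : measurable_fun [set: borel_mx R n 1]
  (fun x : borel_mx R n 1 => (x : 'cV[R]_n) i 0 * (x : 'cV[R]_n) j 0).
Proof. by apply: measurable_funM; exact: measurable_entry. Qed.

(** Squares come first: their integrands are nonnegative, so the finite second moment is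
    integrability. Mixed products are then dominated by sums of two squares. *)
Lemma integrable_coord_sqr (i : 'I_n) : D.-integrable setT
  (fun x : borel_mx R n 1 => ((x : 'cV[R]_n) i 0 * (x : 'cV[R]_n) i 0)%:E).
Proof.
apply/integrableP; split; first by apply/measurable_EFinP; exact: (measurable_coordM i i).
under eq_integral => x _ do rewrite gee0_abs ?lee_fin -?expr2 ?sqr_ge0 // expr2.
by rewrite hD ltry.
Qed.

Lemma integrable_coordM (i j : 'I_n) : D.-integrable setT
  (fun x : borel_mx R n 1 => ((x : 'cV[R]_n) i 0 * (x : 'cV[R]_n) j 0)%:E).
Proof.
apply: (le_integrable measurableT _ _
  (integrableD measurableT (integrable_coord_sqr i) (integrable_coord_sqr j))).
  by apply/measurable_EFinP; exact: (measurable_coordM i j).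
move=> x _ /=; rewrite lee_fin [leRHS]ger0_norm; last first.
  by rewrite addr_ge0 // -expr2 sqr_ge0.
set a := (x : 'cV[R]_n) i 0; set b := (x : 'cV[R]_n) j 0.
rewrite ler_norml; apply/andP; split.
  by have := sqr_ge0 (a + b); have := sqr_ge0 a; have := sqr_ge0 b; nra.
by have := sqr_ge0 (a - b); have := sqr_ge0 a; have := sqr_ge0 b; nra.
Qed.

Lemma integral_quad_form W :
  (\int[D]_x (quad_form W (x : 'cV[R]_n))%:E = (\tr W)%:E)%E.
Proof.
transitivity (\sum_i \sum_j ((W i j)%:E * ((1%:M : 'M[R]_n) i j)%:E))%E.
  under eq_integral => x _.
    rewrite quad_formE -sumEFin.
    under eq_bigr do rewrite -sumEFin.
    over.
  rewrite /= integral_sum //; last first.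
    move=> i; under eq_fun do under eq_bigr do rewrite EFinM.
    apply: integrable_sum => // j.
    by move=> _; exact: (integrableZl measurableT (W i j) (integrable_coordM i j)).
  apply: eq_bigr => i _; rewrite integral_sum //; last first.
    move=> j; under eq_fun do rewrite EFinM.
    exact: (integrableZl measurableT (W i j) (integrable_coordM i j)).
  apply: eq_bigr => j _; under eq_integral do rewrite EFinM.
  by rewrite integralZl ?hD //; exact: integrable_coordM.
rewrite /mxtrace -sumEFin; apply: eq_bigr => i _.
rewrite (bigD1 i) //= big1 ?adde0 => [|j /negPf ji].
  by rewrite mxE eqxx mule1.
by rewrite mxE eq_sym ji mule0.
Qed.

End QuadraticForm.

(** * The LQR cost as a series of traces *)

Section LQRCost.
Variables (R : realType) (n m : nat).
Variables (A : 'M[R]_n) (B : 'M[R]_(n, m)) (Q : 'M[R]_n) (Rc : 'M[R]_m).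
Hypotheses (hQ : sym_posdef Q) (hRc : sym_posdef Rc).
Variable D : probability (borel_mx R n 1) R.
Hypothesis hD : forall i j : 'I_n,
  (\int[D]_x ((x : 'cV[R]_n) i 0 * (x : 'cV[R]_n) j 0)%:E
   = ((1%:M : 'M[R]_n) i j)%:E)%E.
Implicit Types (K : 'M[R]_(m, n)) (x : 'cV[R]_n).

(** The matrix of the [i]-th stage cost as a quadratic form in the initial state; by isotropy its
    trace is the expected stage cost. *)
Definition stage_matrix K i : 'M[R]_n :=
  ((A - B *m K) ^+ i)^T *m (Q + K^T *m Rc *m K) *m (A - B *m K) ^+ i.

Lemma lqr_stateE K x i : lqr_state A B K x i = (A - B *m K) ^+ i *m x.
Proof.
elim: i => [|i IH]; first by rewrite expr0 mul1mx.
rewrite /lqr_state iterS -/(lqr_state A B K x i) IH exprS /lqr_action.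
transitivity ((A - B *m K) *m ((A - B *m K) ^+ i *m x)); last by rewrite mulmxA.
by rewrite mulmxBl mulmxN !mulmxA.
Qed.

Lemma lqr_stage_costE K x i :
  lqr_stage_cost Q Rc K (lqr_state A B K x i) = quad_form (stage_matrix K i) x.
Proof.
rewrite lqr_stateE /lqr_stage_cost /lqr_action quad_formN [X in _ + X]quad_form_mulmx.
by rewrite -quad_formD quad_form_mulmx.
Qed.

Lemma lqr_stage_cost_ge0 K x : 0 <= lqr_stage_cost Q Rc K x.
Proof. by rewrite addr_ge0 // quad_form_ge0. Qed.

Lemma measurable_quad_form (W : 'M[R]_n) : measurable_fun [set: borel_mx R n 1]
  (fun x : borel_mx R n 1 => quad_form W (x : 'cV[R]_n)).
Proof.
under eq_fun do rewrite quad_formE.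
apply: measurable_sum => i; apply: measurable_sum => j.
by apply: measurable_funM => //; exact: (measurable_coordM i j).
Qed.

Lemma lqr_costE K :
  lqr_cost A B Q Rc D K = (\sum_(0 <= i <oo) (\tr (stage_matrix K i))%:E)%E.
Proof.
rewrite /lqr_cost integral_nneseries //.
- apply: eq_eseriesr => i _; rewrite -(integral_quad_form hD).
  by apply: eq_integral => x _; rewrite lqr_stage_costE.
- move=> i; under eq_fun do rewrite lqr_stage_costE.
  by apply/measurable_EFinP; exact: (measurable_quad_form (stage_matrix K i)).
- by move=> i x _; rewrite lee_fin lqr_stage_cost_ge0.
Qed.

Lemma tr_stage_matrix_ge0 K i : 0 <= \tr (stage_matrix K i).
Proof.
rewrite -lee_fin -(integral_quad_form hD); apply: integral_ge0 => x _.
by rewrite lee_fin -lqr_stage_costE lqr_stage_cost_ge0.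
Qed.

Lemma lqr_cost_ge0 K : (0 <= lqr_cost A B Q Rc D K)%E.
Proof.
by rewrite lqr_costE; apply: nneseries_ge0 => i _ _; rewrite lee_fin tr_stage_matrix_ge0.
Qed.

Lemma measurable_lqr_cost :
  measurable_fun [set: borel_mx R m n]
    (fun K : borel_mx R m n => lqr_cost A B Q Rc D (K : 'M[R]_(m, n))).
Proof.
under eq_fun do rewrite lqr_costE.
apply: ge0_emeasurable_sum => [i K _ _|i _].
  by rewrite lee_fin tr_stage_matrix_ge0.
apply/measurable_EFinP; apply: measurable_mxtrace.
have mK : measurable_mx (fun K : borel_mx R m n => (K : 'M[R]_(m, n))).
  by move=> j k; exact: measurable_entry.
have mA : measurable_mx (fun K : borel_mx R m n => (A - B *m (K : 'M[R]_(m, n))) ^+ i).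
  apply: measurable_mxX; apply: measurable_mxB; first exact: measurable_mx_cst.
  by apply: measurable_mulmx => //; exact: measurable_mx_cst.
apply: measurable_mulmx => //; apply: measurable_mulmx; first exact: measurable_trmx.
apply: measurable_mxD; first exact: measurable_mx_cst.
apply: measurable_mulmx => //; apply: measurable_mulmx; first exact: measurable_trmx.
exact: measurable_mx_cst.
Qed.

Lemma stable_lqr_cost_fin K : stable A B K -> (lqr_cost A B Q Rc D K < +oo)%E.
Proof.
move=> /summable_powers [M hM].
pose a i := \sum_j \sum_k `|((A - B *m K) ^+ i) j k|.
pose w := \sum_j \sum_k `|(Q + K^T *m Rc *m K) j k|.
have a0 i : 0 <= a i by do 2 apply: sumr_ge0 => ? _.
have w0 : 0 <= w by do 2 apply: sumr_ge0 => ? _.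
have le_a i j k : `|((A - B *m K) ^+ i) j k| <= a i.
  rewrite /a (bigD1 j) //= (bigD1 k) //= -addrA lerDl addr_ge0 ?sumr_ge0 //.
  by move=> l _; apply: sumr_ge0.
have aM i : a i <= M.
  apply: le_trans (hM i.+1); rewrite big_ord_recr /= lerDr.
  by apply: sumr_ge0 => l _; exact: a0.
(* The trace is quadratic in the closed-loop power. Bounding one of the two factors [a i] by the
   total [M] leaves a summable term; [n] counts the diagonal entries. *)
have bound i : \tr (stage_matrix K i) <= (n%:R * w * M) * a i.
  apply: le_trans (_ : n%:R * w * a i * a i <= _); last first.
    by rewrite -!mulrA ler_wpM2l // ler_wpM2l // ler_wpM2r.
  rewrite /mxtrace; apply: le_trans (_ : \sum_(j < n) w * a i * a i <= _); last first.
    by rewrite sumr_const card_ord -[leLHS]mulr_natl !mulrA.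
  apply: ler_sum => j _.
  rewrite mxE /w !mulr_suml.
  under eq_bigr => k _ do rewrite mxE mulr_suml.
  rewrite exchange_big /=; apply: ler_sum => k _.
  rewrite !mulr_suml; apply: ler_sum => l _.
  rewrite mxE; apply: le_trans (ler_norm _) _; rewrite !normrM.
  rewrite [`|_| * `|(Q + _) _ _|]mulrC -!mulrA.
  by apply: ler_wpM2l => //; apply: ler_pM.
rewrite lqr_costE.
apply: (@le_lt_trans _ _ (n%:R * w * M * M)%:E); last by rewrite ltry.
apply: lime_le.
  by apply: is_cvg_nneseries => i _ _; rewrite lee_fin tr_stage_matrix_ge0.
apply: nearW => N; rewrite big_mkord sumEFin lee_fin.
apply: (@le_trans _ _ (\sum_(i < N) (n%:R * w * M) * a i)).
  by apply: ler_sum => i _; exact: bound.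
rewrite -mulr_sumr; apply: ler_wpM2l; last exact: hM.
by rewrite !mulr_ge0 //; apply: le_trans (hM 0%N); rewrite big_ord0.
Qed.

End LQRCost.

(** * Measurability of the gradient from a quadratic upper bound *)

Section MeasurableGradient.
Variables (R : realType) (p q : nat) (f : 'M[R]_(p, q) -> R).
Hypothesis mf : measurable_fun [set: borel_mx R p q] (f : borel_mx R p q -> R).
Variables (U : set 'M[R]_(p, q)) (L r : R).
Hypothesis mU : measurable (U : set (borel_mx R p q)).
Hypothesis r0 : 0 < r.
Hypothesis smooth : forall K K', U K -> frob_norm (K' - K) <= r ->
  f K' <= f K + frob_inner (gradient f K) (K' - K)
              + L / 2 * frob_norm (K - K') ^+ 2.
Variables (i : 'I_p) (j : 'I_q).

Let E : 'M[R]_(p, q) := delta_mx i j.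
Let quot (K : 'M[R]_(p, q)) (h : R) := h^-1 * (f (h *: E + K) - f K).
Let hn (n : nat) : R := n.+1%:R^-1.
Let gap n K := quot K (- hn n) - quot K (hn n).

Let frobE h : frob_norm (h *: E) = `|h|.
Proof.
rewrite frob_normZ /frob_norm frob_inner_delta mxE !eqxx sqrtr1 mulr1 //.
Qed.

Let hn_gt0 n : 0 < hn n. Proof. by rewrite invr_gt0. Qed.

Let hn_cvg0 : hn n @[n --> \oo] --> 0.
Proof. exact: cvg_harmonic. Qed.

(* The gradient entry always lies between the two one-sided difference
   quotients, up to O(h): this follows from the quadratic upper bound alone. *)
Let quot_sandwich K h : U K -> 0 < h <= r ->
  quot K h - L / 2 * h <= gradient f K i j <= quot K (- h) + L / 2 * h.
Proof.
move=> UK /andP[h0 hr].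
have sm a : `|a| <= r ->
    f (a *: E + K) - f K <= a * gradient f K i j + L / 2 * a ^+ 2.
  move=> ar; have := smooth UK (K' := a *: E + K).
  rewrite addrK frob_distC addrK frobE real_normK ?num_real // => /(_ ar).
  by rewrite frob_innerZr frob_inner_delta; lra.
have e1 : f (h *: E + K) - f K <= h * gradient f K i j + L / 2 * h ^+ 2.
  by apply: sm; rewrite ger0_norm // ltW.
have e2 : f (- h *: E + K) - f K <= - h * gradient f K i j + L / 2 * (- h) ^+ 2.
  by apply: sm; rewrite normrN ger0_norm // ltW.
apply/andP; split.
  rewrite /quot lerBlDr -(ler_pM2l h0) mulVKf ?gt_eqF //.
  by apply: le_trans e1 _; rewrite le_eqVlt; apply/orP; left; apply/eqP; ring.
rewrite /quot invrN mulNr -lerBlDr -(ler_pM2l h0) mulrN mulVKf ?gt_eqF //.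
lra.
Qed.

(* If the symmetric gap does not vanish then [f] is not differentiable and the
   gradient entry is the junk value of [lim]; if it does, the sandwich forces
   the quotients to converge to the gradient entry.  So the measurable condition
   [gap n K --> 0] decides which of the two formulas holds. *)
Let gap_cvg_derivable K : derivable f K E -> gap n K @[n --> \oo] --> 0.
Proof.
move=> df.
have /cvgr_dnbhsP h : quot K a @[a --> 0^'] --> 'D_E f K by exact: df.
rewrite -(subrr ('D_E f K)); apply: cvgB; apply: h; split.
- by move=> n; rewrite oppr_eq0 gt_eqF.
- by rewrite -oppr0; apply: cvgN.
- by move=> n; rewrite gt_eqF.
- exact: hn_cvg0.
Qed.

Let gap_cvg_gradient K : U K -> gap n K @[n --> \oo] --> 0 ->
  quot K (hn n) @[n --> \oo] --> gradient f K i j.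
Proof.
move=> UK g0.
have nr : \forall n \near \oo, hn n <= r.
  exact: (cvgr_le _ hn_cvg0 _ r0).
have gl : (gradient f K i j - gap n K - L / 2 * hn n) @[n --> \oo] --> gradient f K i j.
  rewrite -[X in _ --> X]subr0 -[X in _ --> X]subr0; apply: cvgB.
    by apply: cvgB => //; exact: cvg_cst.
  by rewrite -(mulr0 (L / 2)); apply: cvgM; [exact: cvg_cst|exact: hn_cvg0].
have gu : (gradient f K i j + L / 2 * hn n) @[n --> \oo] --> gradient f K i j.
  rewrite -[X in _ --> X]addr0; apply: cvgD; first exact: cvg_cst.
  by rewrite -(mulr0 (L / 2)); apply: cvgM; [exact: cvg_cst|exact: hn_cvg0].
apply: (squeeze_cvgr _ gl gu); near=> n.
have hr : 0 < hn n <= r by rewrite hn_gt0; near: n.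
have /andP[] := quot_sandwich UK hr; rewrite /gap; lra.
Unshelve. all: by end_near. Qed.

Let gradient_not_derivable K : ~ derivable f K E -> gradient f K i j = point.
Proof. by move=> nd; rewrite mxE; exact: dvgP. Qed.

Let mquot h : measurable_fun [set: borel_mx R p q]
  (fun K : borel_mx R p q => quot K h).
Proof.
apply: measurable_funM => //; apply: measurable_funB => //.
under eq_fun do rewrite addrC.
exact: (measurableT_comp mf (measurable_translate (h *: E))).
Qed.

Lemma measurable_gradient_entry : measurable_fun (U : set (borel_mx R p q))
  (fun K : borel_mx R p q => gradient f K i j).
Proof.
have mgap n : measurable_fun [set: borel_mx R p q] (fun K : borel_mx R p q => gap n K).
  by apply: measurable_funB; exact: mquot.
(* Convergence of the gap to 0, written with countable operations so that it is a Borel condition on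
   [K]. *)
pose V : set (borel_mx R p q) := \bigcap_k \bigcup_N \bigcap_(n >= N)
  [set K : borel_mx R p q | `|gap n K| <= k.+1%:R^-1].
have VE K : V K <-> gap n K @[n --> \oo] --> 0.
  split => [VK|g0 k _].
    apply/cvgrPdist_le => e e0.
    have [k ke] : exists k, k.+1%:R^-1 <= e.
      exists (Num.bound e^-1); rewrite invf_ple ?posrE //.
      by rewrite (le_trans (ltW (archi_boundP _))) ?ler_nat // ?invr_ge0 ltW.
    have [N _ hN] := VK k I; exists N => // n Nn.
    by rewrite sub0r normrN; apply: le_trans ke; exact: hN.
  have /cvgrPdist_le /(_ k.+1%:R^-1) := g0.
  rewrite invr_gt0 ltr0n => /(_ isT) [N _ hN]; exists N => // n Nn /=.
  by have := hN n Nn; rewrite sub0r normrN.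
have mV : measurable V.
  apply: bigcapT_measurable => k; apply: bigcupT_measurable => N.
  apply: bigcap_measurable => // [|n _]; first by exists N => /=.
  rewrite (_ : [set K | _] = setT `&`
      ((fun y : R => `|y|) \o gap n) @^-1` `]-oo, k.+1%:R^-1]%classic).
    have : measurable_fun [set: borel_mx R p q] ((fun y : R => `|y|) \o gap n).
      by apply: measurableT_comp => //; exact: mgap.
    by apply.
  by rewrite setTI; apply/seteqP; split => K; rewrite /= in_itv.
have mUV : measurable (U `&` V : set (borel_mx R p q)) by exact: measurableI.
have mUD : measurable (U `\` V : set (borel_mx R p q)) by exact: measurableD.
rewrite -(setUIDK U V).
apply/(measurable_funU _ mUV mUD); split.
  apply: (@measurable_fun_cvg _ _ _ _ (fun n (K : borel_mx R p q) => quot K (hn n))).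
    by move=> n; apply: measurable_funTS; exact: mquot.
  by move=> K [UK /VE]; exact: gap_cvg_gradient.
apply: (@eq_measurable_fun _ _ _ _ _ (fun=> point)); last exact: measurable_cst.
move=> K; rewrite inE => -[UK nV]; rewrite gradient_not_derivable //.
by move=> /gap_cvg_derivable /VE.
Qed.

End MeasurableGradient.

(** * The deterministic recursion and its rate *)

Section Recursion.
Variable R : realType.

(* Multiplying the one-step inequality by [(N+t)(N+t-1)] makes the
   contraction factor [1 - 2/(N+t)] telescope. *)
Lemma weighted_descent (mu L M N : R) (x z : nat -> R) (t : nat) :
  0 < mu -> 0 < L -> 4 <= N ->
  (forall s, (s < t)%N -> x s.+1 <= x s - (2 / (mu * (N + s%:R))) * (mu * x s - z s)
       + L / 2 * ((2 / (mu * (N + s%:R))) * M) ^+ 2) ->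
  (N + t%:R - 1) * (N + t%:R - 2) * x t <=
    (N - 1) * (N - 2) * x 0%N + \sum_(s < t) (2 * (N + s%:R - 1) / mu) * z s
    + 2 * (L / mu ^+ 2) * M ^+ 2 * t%:R.
Proof.
move=> mu0 L0 N4; elim: t => [|t IH] step.
  by rewrite big_ord0 !addr0 mulr0 addr0.
have {}IH := IH (fun s st => step s (ltnW st)).
rewrite big_ord_recr /=; have := step t (ltnSn t).
have -> : N + t.+1%:R = N + t%:R + 1 by rewrite -natr1 addrA.
have -> : t.+1%:R = t%:R + 1 :> R by rewrite natr1.
set n := N + t%:R in IH *.
have n4 : 4 <= n by rewrite /n; have := ler0n R t; lra.
have n0 : n != 0 by rewrite gt_eqF //; lra.
have mun0 : mu != 0 by rewrite gt_eqF.
move=> hx.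
have w0 : 0 <= n * (n - 1) by rewrite mulr_ge0 //; lra.
have {hx} := ler_wpM2l w0 hx.
set S := \sum_(s < t) _ in IH *.
have -> : n * (n - 1) * (x t - 2 / (mu * n) * (mu * x t - z t)
     + L / 2 * (2 / (mu * n) * M) ^+ 2) =
   (n - 1) * (n - 2) * x t + 2 * (n - 1) / mu * z t
   + 2 * (L / mu ^+ 2) * M ^+ 2 * (1 - n^-1).
  by field; apply/andP; split.
have k0 : 0 <= 2 * (L / mu ^+ 2) * M ^+ 2.
  have k : 0 <= L / mu ^+ 2 by rewrite divr_ge0 ?sqr_ge0 ?ltW.
  by apply: mulr_ge0; [exact: mulr_ge0|exact: sqr_ge0].
(* The step error carries the factor [1 - n^-1], rounded up to 1 so that every step contributes the
   same amount. *)
have k1 : 0 <= 2 * (L / mu ^+ 2) * M ^+ 2 * n^-1.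
  by rewrite mulr_ge0 // invr_ge0; lra.
rewrite (_ : n + 1 - 1 = n); last by ring.
rewrite (_ : n + 1 - 2 = n - 1); last by ring.
lra.
Qed.

Lemma sum_arith (N : R) (t : nat) :
  \sum_(s < t) (N + s%:R - 1) =
    ((N + t%:R - 1) * (N + t%:R - 2) - (N - 1) * (N - 2)) / 2.
Proof.
elim: t => [|t IH]; first by rewrite big_ord0 addr0 subrr mul0r.
by rewrite big_ord_recr /= IH -natr1; field.
Qed.

(* Here [kap = L / mu^2], [H = (M + G)^2], [l = log (1 / delta)], [B] is the
   bias [G beta / mu], [v s] the squared range of the [s]-th weighted noise
   term and [lam] the Chernoff parameter. *)
Lemma rate_of_weighted_bound (kap M H l B N D0 x lam : R) (v : nat -> R) (t : nat) :
  let C := 2 * (N * D0 + 8 * kap * (M ^+ 2 + 768 * H * l)) in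
  let n := N + t%:R - 1 in
  0 < kap -> 0 < H -> 0 <= l -> 0 <= B -> 4 <= N -> 0 <= D0 -> (0 < t)%N ->
  lam = (64 * n * kap * H)^-1 ->
  (forall s, (s < t)%N ->
     v s <= 8 * kap * H * (N + s%:R - 1) ^+ 2 * (2 * B + C / (N + s%:R))) ->
  n * (n - 1) * x <= (N - 1) * (N - 2) * D0
    + (\sum_(s < t) 2 * (N + s%:R - 1) * B + 2 * lam * (\sum_(s < t) v s)
       + l / lam) + 2 * kap * M ^+ 2 * t%:R ->
  x <= 2 * B + C / (N + t%:R).
Proof.
move=> C n k0 H0 l0 B0 N4 D00 t0 lamE vle.
have nE : n = N + t%:R - 1 by [].
have m0 : 0 <= kap * M ^+ 2 by rewrite mulr_ge0 ?sqr_ge0 // ltW.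
have kH0 : 0 < kap * H by rewrite mulr_gt0.
have h0 : 0 <= kap * H * l by rewrite mulr_ge0 // ltW.
have a0 : 0 <= N * D0 by rewrite mulr_ge0 //; clear -N4; lra.
(* The constants anticipate the end of the proof. As [n >= 4], [C / (n + 1)] is at least
   [4 / 5 * C / n], and the noise ranges cost [C / 8], which leaves [27 / 40]; 86 bounds
   [64 * n / (n - 1)]. *)
have Cbig : N * D0 + 86 * (kap * H * l) + 2 * (kap * M ^+ 2) <= 27 / 40 * C.
  rewrite /C [8 * kap * _](_ : _ = 8 * (kap * M ^+ 2) + 8 * 768 * (kap * H * l)).
    clear -m0 h0 a0; lra.
  by ring.
clearbody C n.
have t1 : 1 <= t%:R :> R by rewrite ler1n.
have n4 : 4 <= n by rewrite nE; lra.
have n0 : 0 < n by lra.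
have C0 : 0 <= C by clear -Cbig m0 h0 a0; lra.
have NN0 : 0 <= (N - 1) * (N - 2) by rewrite mulr_ge0 //; lra.
have sumE : \sum_(s < t) (N + s%:R - 1) <= n * (n - 1) / 2.
  rewrite sum_arith (_ : N + t%:R - 2 = n - 1); last by rewrite nE; ring.
  rewrite -nE; lra.
(* One factor [N + s - 1] turns [2 * B + C / (N + s)] into at most [2 * B * n + C], since [s < t]
   gives [N + s <= n]; the other factor is summed as an arithmetic progression. *)
have vsum : \sum_(s < t) v s <= 8 * kap * H * (2 * B * n + C) * (n * (n - 1) / 2).
  apply: (@le_trans _ _ (\sum_(s < t)
     8 * kap * H * (2 * B * n + C) * (N + s%:R - 1))).
    apply: ler_sum => s _; apply: le_trans (vle s (ltn_ord s)) _.
    set y := N + s%:R.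
    have yn : y <= n.
      have : s.+1%:R <= t%:R :> R by rewrite ler_nat.
      by rewrite -natr1 nE /y; lra.
    have y4 : 4 <= y by rewrite /y; have := ler0n R s; lra.
    clearbody y; clear vle.
    have y1 : 0 <= y - 1 by lra.
    rewrite -!(mulrA (8 * kap * H)) ler_wpM2l //; first by rewrite -mulrA mulr_ge0 // ltW.
    rewrite expr2 -mulrA [leRHS]mulrC; apply: ler_wpM2l => //.
    rewrite mulrDr; apply: lerD.
      by rewrite mulrC; apply: ler_wpM2l; [rewrite mulr_ge0|lra].
    rewrite mulrCA ler_piMr // ler_pdivrMr; lra.
  rewrite -mulr_sumr ler_wpM2l // mulr_ge0 //.
    by rewrite -mulrA mulr_ge0 // ltW.
  by rewrite addr_ge0 // !mulr_ge0 // ltW.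
clear vle.
have lam0 : 0 < lam by rewrite lamE invr_gt0 -mulrA !mulr_gt0.
(* The 64 in [lam] is what produces the eighth: the bias then totals [B + B / 4], within the allowed
   [2 * B]. *)
have lv : 2 * lam * (\sum_(s < t) v s) <= (2 * B * n + C) * (n - 1) / 8.
  apply: le_trans (ler_wpM2l _ vsum) _; first by rewrite mulr_ge0 // ltW.
  rewrite lamE le_eqVlt; apply/orP; left; apply/eqP.
  by field; rewrite !gt_eqF.
have ll : l / lam = 64 * n * (kap * H * l) by rewrite lamE invrK; ring.
have eb : \sum_(s < t) 2 * (N + s%:R - 1) * B <= B * (n * (n - 1)).
  rewrite (eq_bigr (fun s : 'I_t => 2 * B * (N + s%:R - 1))); last first.
    by move=> s _; ring.
  rewrite -mulr_sumr; apply: le_trans (ler_wpM2l _ sumE) _; first by rewrite mulr_ge0.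
  lra.
have n1 : 0 <= n - 1 by lra.
have ha : (N - 1) * (N - 2) * D0 <= N * D0 * (n - 1).
  rewrite mulrAC; apply: ler_pM.
  - by rewrite mulr_ge0 //; lra.
  - lra.
  - by rewrite ler_wpM2r //; lra.
  - by rewrite nE; lra.
have hm : 2 * kap * M ^+ 2 * t%:R <= 2 * (kap * M ^+ 2) * (n - 1).
  rewrite -(mulrA 2) ler_wpM2l //; first by rewrite mulr_ge0.
  by rewrite nE; lra.
have hl : 64 * n * (kap * H * l) <= 86 * (kap * H * l) * (n - 1).
  rewrite [leLHS]mulrC [86 * _]mulrC -[leRHS]mulrA mulrC.
  rewrite [leLHS]mulrC; apply: ler_wpM2l => //; lra.
move=> hx.
have {hx} : (n - 1) * (n * x) <= (n - 1) * (N * D0 + B * n + (2 * B * n + C) / 8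
    + 86 * (kap * H * l) + 2 * (kap * M ^+ 2)).
  rewrite mulrCA mulrA; apply: le_trans hx _; rewrite ll.
  clear -ha hm hl eb lv; lra.
rewrite ler_pM2l; last lra.
move=> hx.
have nC : C / (N + t%:R) >= (4 / 5) * C / n.
  rewrite (_ : N + t%:R = n + 1); last by rewrite nE; ring.
  rewrite mulrAC [X in _ <= X]mulrC ler_wpM2r // ler_pdivrMr // ler_pdivlMl; lra.
apply: le_trans (lerD (lexx _) nC).
rewrite -(ler_pM2l n0) mulrDr [n * (_ / n)]mulrC divfK ?gt_eqF //.
apply: le_trans hx _.
have Bn0 : 0 <= B * n by rewrite mulr_ge0 // ltW.
clear -Bn0 Cbig; lra.
Qed.

End Recursion.

(** * Almost sure comparison and equality of conditional expectations *)

Section ConditionalEquality.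
Context (R : realType) (d : measure_display) (T : measurableType d).
Variables (P : probability T R).

Lemma ae_le_Rintegral (D : set T) (X Y : T -> R) : measurable D ->
  P.-integrable D (EFin \o X) -> P.-integrable D (EFin \o Y) ->
  {ae P, forall x, D x -> X x <= Y x} ->
  (\int[P]_(x in D) X x <= \int[P]_(x in D) Y x)%R.
Proof.
move=> mD iX iY XY.
(* Adding [h] to both sides makes the integrands nonnegative, which reduces the claim to the
   comparison of nonnegative integrals. *)
pose h x := `|X x| + `|Y x|.
have ih : P.-integrable D (EFin \o h).
  exact: (integrable_add mD (integrable_norm iX) (integrable_norm iY)).
have h0 (Z : T -> R) x : `|Z x| <= h x -> 0 <= Z x + h x.
  by rewrite ler_norml => /andP[]; lra.
have iXh := integrable_add mD iX ih; have iYh := integrable_add mD iY ih.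
suff : (\int[P]_(x in D) (X x + h x) <= \int[P]_(x in D) (Y x + h x))%R.
  by rewrite (RintegralD mD iX ih) (RintegralD mD iY ih) lerD2r.
apply: fine_le; [exact: integrable_fin_num|exact: integrable_fin_num|].
apply: ae_ge0_le_integral => //.
- by move=> x _; rewrite lee_fin h0 // /h lerDl.
- exact: measurable_int iXh.
- by move=> x _; rewrite lee_fin h0 // /h lerDr.
- exact: measurable_int iYh.
- by apply: filterS XY => x XY Dx; rewrite lee_fin lerD2r XY.
Qed.

Variable F : set (set T).
Hypotheses (sF : sigma_algebra [set: T] F) (Fm : F `<=` measurable).
Variable S : set T.
Hypothesis FS : F S.

(* [X] and [Y] have the same conditional expectation given [F] on [S]; unlike in
   [condexp_on], [Y] need not be measurable with respect to [F], which makes the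
   relation stable under adding the same integrable function on both sides. *)
Definition cond_eq (X Y : T -> R) : Prop :=
  [/\ P.-integrable S (EFin \o X), P.-integrable S (EFin \o Y) &
      forall (W : T -> R) c, measurable_wrt F W -> (forall x, S x -> `|W x| <= c) ->
        (\int[P]_(x in S) (W x * X x) = \int[P]_(x in S) (W x * Y x))%R].

Let mS : measurable S. Proof. exact: Fm. Qed.

Let mWS (W : T -> R) : measurable_wrt F W -> measurable_fun S W.
Proof. by move=> mW; exact: measurable_funTS (measurable_wrt_fun Fm mW). Qed.

Lemma condexp_on_cond_eq X Y : condexp_on P F S X Y -> cond_eq X Y.
Proof.
move=> XY; have [_ iX iY _] := XY; split=> // W c mW Wc.
exact: (condexp_on_pullout sF Fm FS XY mW Wc).
Qed.

Lemma cond_eq_refl X : P.-integrable S (EFin \o X) -> cond_eq X X.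
Proof. by []. Qed.

Lemma cond_eqD X1 Y1 X2 Y2 : cond_eq X1 Y1 -> cond_eq X2 Y2 ->
  cond_eq (fun x => X1 x + X2 x) (fun x => Y1 x + Y2 x).
Proof.
move=> [iX1 iY1 e1] [iX2 iY2 e2]; split.
- exact: (integrable_add mS iX1 iX2).
- exact: (integrable_add mS iY1 iY2).
move=> W c mW Wc.
have iW Z : P.-integrable S (EFin \o Z) ->
    P.-integrable S (EFin \o (fun x => W x * Z x)).
  exact: (integrable_mul_bounded mS (mWS mW) Wc).
transitivity (\int[P]_(x in S) (W x * X1 x + W x * X2 x))%R.
  by apply: eq_Rintegral => x _; rewrite mulrDr.
rewrite (RintegralD mS (iW _ iX1) (iW _ iX2)) (e1 _ _ mW Wc) (e2 _ _ mW Wc).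
rewrite -(RintegralD mS (iW _ iY1) (iW _ iY2)).
by apply: eq_Rintegral => x _; rewrite mulrDr.
Qed.

Lemma cond_eqM (V X Y : T -> R) c :
  measurable_wrt F V -> (forall x, S x -> `|V x| <= c) ->
  cond_eq X Y -> cond_eq (fun x => V x * X x) (fun x => V x * Y x).
Proof.
move=> mV Vc [iX iY e].
split; [exact: (integrable_mul_bounded mS (mWS mV) Vc)..|].
move=> W c' mW Wc'.
have mWV : measurable_wrt F (fun x => W x * V x).
  by apply/(measurable_wrtP sF); apply: measurable_funM; exact/(measurable_wrtP sF).
have WVc x : S x -> `|W x * V x| <= c' * c.
  by move=> Sx; rewrite normrM ler_pM // ?Vc ?Wc'.
have := e _ _ mWV WVc.
by under eq_Rintegral do rewrite -mulrA; under [in RHS]eq_Rintegral do rewrite -mulrA.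
Qed.

Lemma cond_eq_sum (I : Type) (s : seq I) (X Y : I -> T -> R) :
  (forall i, cond_eq (X i) (Y i)) ->
  cond_eq (fun x => \sum_(i <- s) X i x) (fun x => \sum_(i <- s) Y i x).
Proof.
move=> XY; elim: s => [|i s IH].
  rewrite (_ : (fun x => _) = fun=> 0); last by apply/funext => x; rewrite big_nil.
  rewrite (_ : (fun x => \sum_(i <- [::]) Y i x) = fun=> 0); last first.
    by apply/funext => x; rewrite big_nil.
  apply: cond_eq_refl; apply: (@integrable_bounded _ _ _ _ _ _ (0)) => //.
  by move=> x _; rewrite normr0.
have -> Z : (fun x => \sum_(j <- i :: s) Z j x) =
    (fun x : T => Z i x + \sum_(j <- s) Z j x : R).
  by apply/funext => x; rewrite big_cons.
rewrite (_ : (fun x => \sum_(j <- i :: s) Y j x) =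
    (fun x => Y i x + \sum_(j <- s) Y j x)); last first.
  by apply/funext => x; rewrite big_cons.
exact: cond_eqD.
Qed.

End ConditionalEquality.

(** * Range and bias of one truncated noise term *)

Section NoiseStep.
Context (R : realType) (d : measure_display) (T : measurableType d).
Variables (P : probability T R) (F : set (set T)).
Hypotheses (sF : sigma_algebra [set: T] F) (Fm : F `<=` measurable).
Variables (S0 S : set T).
Hypotheses (FS0 : F S0) (FS : F S) (SS0 : S `<=` S0).
Variables (p q : nat) (G gam Y : T -> 'M[R]_(p, q)) (Y2 Y3 : T -> R).
Variables (b V M Gm dl : R).
Hypotheses (V0 : 0 < V) (dl0 : 0 < dl) (b0 : 0 <= b) (M0 : 0 <= M).
Hypothesis mG : forall i j, measurable_fun setT (fun w => G w i j).
Hypothesis mgam : forall i j, measurable_wrt F (fun w => gam w i j).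
Hypothesis gamS : forall w, ~ S w -> gam w = 0.
Hypothesis gamG : forall w, frob_norm (gam w) <= Gm.
Hypothesis GY : forall i j, condexp_on P F S0 (fun w => G w i j) (fun w => Y w i j).
Hypothesis Yb : {ae P, forall w, S w -> frob_norm (Y w - gam w) <= b}.
Hypothesis GY2 : condexp_on P F S0 (fun w => frob_norm (G w) ^+ 2) Y2.
Hypothesis Y2V : {ae P, forall w, S0 w -> Y2 w <= V}.
Hypothesis GY3 : condexp_on P F S0 (\1_[set w | frob_norm (G w) <= M]) Y3.
Hypothesis Y3d : {ae P, forall w, S0 w -> 1 - dl <= Y3 w}.

Let I w : R := \1_[set w | frob_norm (G w) <= M] w.
Let alp : R := Num.sqrt dl / Num.sqrt V.
Let pen2 w := \1_S w * (Gm / 2 * alp) : R.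
Let pen3 w := \1_S w * (Gm / 2 / alp) : R.
(* The truncated part [<gam, G 1(|G| > M)>] is bounded by AM-GM with weight
   [alp], which is the optimal choice in
   [(alp V + dl / alp) / 2 = sqrt (V dl)]. *)
Let Phi w := frob_inner (gam w) (gam w) + - 1 * frob_inner (gam w) (G w)
   + (pen2 w * frob_norm (G w) ^+ 2 + (pen3 w + - pen3 w * I w)).
Let Psi w := frob_inner (gam w) (gam w) + - 1 * frob_inner (gam w) (Y w)
   + (pen2 w * Y2 w + (pen3 w + - pen3 w * Y3 w)).

(** Truncation gives the noise a deterministic range and makes it integrable everywhere, whereas [G]
    is known to be integrable only on [S0]. *)
Definition trunc_noise w :=
  frob_inner (gam w) (gam w - I w *: G w).

Let Gm0 : 0 <= Gm := le_trans (frob_norm_ge0 (gam point)) (gamG point).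

Let alp0 : 0 < alp. Proof. by rewrite divr_gt0 ?sqrtr_gt0. Qed.

Let pen2_ge0 : 0 <= Gm / 2 * alp.
Proof. by apply: mulr_ge0; [exact: divr_ge0|exact: ltW]. Qed.

Let pen3_ge0 : 0 <= Gm / 2 / alp.
Proof. by apply: divr_ge0; [exact: divr_ge0|exact: ltW]. Qed.

Let m1S : measurable_wrt F (\1_S : T -> R).
Proof.
apply/(measurable_wrtP sF); apply: measurable_indic.
by rewrite -[X in X S](_ : @measurable _ (g_sigma_algebraType F) = _) //;
  exact: sub_sigma_algebra.
Qed.

Let indS w : (\1_S w : R) = if `[< S w >] then 1 else 0.
Proof.
rewrite indicE; case: asboolP => [Sw|nSw]; first by rewrite mem_set.
by rewrite memNset.
Qed.

Let I01 w : I w = if frob_norm (G w) <= M then 1 else 0.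
Proof.
rewrite /I indicE; case: ifPn => h; first by rewrite mem_set.
by rewrite memNset //=; apply/negP.
Qed.

Lemma trunc_noise_out w : ~ S w -> trunc_noise w = 0.
Proof.
move=> /gamS h; rewrite /trunc_noise h.
by rewrite -[X in frob_inner X _](scale0r 0) frob_innerZl mul0r.
Qed.

Lemma trunc_noise_in w : frob_norm (G w) <= M ->
  trunc_noise w = frob_inner (gam w) (gam w - G w).
Proof. by move=> GM; rewrite /trunc_noise I01 GM scale1r. Qed.

(** One factor [frob_norm (gam w)] is kept instead of [Gm]: it shrinks with the suboptimality, and
    the fast rate depends on it. *)
Lemma normr_trunc_noise w : `|trunc_noise w| <= frob_norm (gam w) * (M + Gm).
Proof.
rewrite /trunc_noise frob_innerBr frob_innerZr.
apply: le_trans (ler_normB _ _) _.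
have h1 : `|frob_inner (gam w) (gam w)| <= frob_norm (gam w) * Gm.
  by apply: le_trans (frob_cauchy_schwarz _ _) _; rewrite ler_wpM2l ?frob_norm_ge0.
have h2 : `|I w * frob_inner (gam w) (G w)| <= frob_norm (gam w) * M.
  rewrite normrM I01; case: ifPn => GM.
    rewrite normr1 mul1r; apply: le_trans (frob_cauchy_schwarz _ _) _.
    by rewrite ler_wpM2l ?frob_norm_ge0.
  by rewrite normr0 mul0r mulr_ge0 ?frob_norm_ge0.
by rewrite mulrDr addrC lerD.
Qed.

Lemma measurable_trunc_noise d' (T' : measurableType d') (f : T' -> T) :
  (forall i j, measurable_fun setT (fun w => G (f w) i j)) ->
  (forall i j, measurable_fun setT (fun w => gam (f w) i j)) ->
  measurable_fun setT (fun w => trunc_noise (f w)).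
Proof.
move=> mGf mgf; rewrite /trunc_noise.
apply: measurable_frob_inner => //.
apply: measurable_mxB => // i j.
rewrite (_ : (fun w => _) = fun w => I (f w) * G (f w) i j); last first.
  by apply/funext => w; rewrite mxE.
apply: measurable_funM => //.
rewrite (_ : (fun w => _) = fun w => if frob_norm (G (f w)) <= M then 1 else 0); last first.
  by apply/funext => w; rewrite I01.
apply: measurable_fun_ifT => //.
apply: measurable_fun_ler => //.
apply: (@measurableT_comp _ _ _ _ _ _ (@Num.sqrt R) _
  (fun w => frob_inner (G (f w)) (G (f w)))).
  by apply: continuous_measurable_fun; exact: sqrt_continuous.
exact: measurable_frob_inner.
Qed.

Let noise_le_Phi w : trunc_noise w <= Phi w.
Proof.
have [Sw|nSw] := pselect (S w); last first.
  rewrite trunc_noise_out // /Phi /pen2 /pen3 indS asboolF // gamS //.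
  rewrite -[X in frob_inner X](scale0r 0) !frob_innerZl !mul0r.
  by rewrite !mulr0 oppr0 mul0r !addr0.
rewrite /trunc_noise /Phi /pen2 /pen3 indS asboolT // frob_innerBr frob_innerZr.
rewrite mulN1r !mul1r -!addrA lerD2l -lerBDl opprK addrC.
have N0 := frob_norm_ge0 (G w).
rewrite I01; case: ifPn => GM.
  by rewrite !mulr1 mul1r !subrr addr0; apply: mulr_ge0 => //; exact: sqr_ge0.
rewrite mul0r oppr0 !mulr0 !addr0.
have h1 : frob_inner (gam w) (G w) <= Gm * frob_norm (G w).
  apply: le_trans (ler_norm _) _; apply: le_trans (frob_cauchy_schwarz _ _) _.
  by rewrite ler_wpM2r.
apply: le_trans h1 _.
(* Expanding this square bounds [Gm * frob_norm (G w)] by the two penalties, both active because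
   [I w = 0] here. *)
have h2 : 0 <= Gm / 2 * alp * (frob_norm (G w) - alp^-1) ^+ 2.
  by apply: mulr_ge0 => //; exact: sqr_ge0.
rewrite -subr_ge0; apply: le_trans h2 _; rewrite le_eqVlt; apply/orP; left; apply/eqP.
by field; rewrite gt_eqF.
Qed.

(** [Phi] is affine in the quantities whose conditional expectations the noise condition describes,
    with bounded [F]-measurable coefficients; [Psi] replaces each of them by its version. *)
Let cond_eq_Phi_Psi : cond_eq P F S0 Phi Psi.
Proof.
have cD := @cond_eqD R d T P F Fm S0 FS0.
have cM := @cond_eqM R d T P F sF Fm S0 FS0.
have gb i j w : S0 w -> `|gam w i j| <= Gm.
  by move=> _; exact: le_trans (normr_le_frob _ _ _) (gamG w).
have pb c w : S0 w -> `|\1_S w * c : R| <= `|c|.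
  by move=> _; rewrite normrM indicE; case: (_ \in _);
    rewrite ?normr1 ?normr0 ?mul1r ?mul0r.
have mp c : measurable_wrt F (fun w => \1_S w * c : R).
  by apply/(measurable_wrtP sF); apply: measurable_funM => //; exact/(measurable_wrtP sF).
have mS0 := Fm FS0.
apply: (cD); first apply: (cD).
- apply: cond_eq_refl; apply: (@integrable_bounded _ _ _ _ _ _ (Gm ^+ 2)) => //.
    apply: measurable_funTS; apply: measurable_frob_inner => i j;
    exact: (measurable_wrt_fun Fm (mgam i j)).
  move=> w _; rewrite -frob_norm_sqr ger0_norm ?sqr_ge0 //.
  by rewrite ler_sqr ?nnegrE ?frob_norm_ge0.
- apply: (cM (fun=> -1) _ _ 1); [|by move=> w _; rewrite normrN1|].
    by apply/(measurable_wrtP sF).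
  have E Z : (fun w => frob_inner (gam w) (Z w)) =
      (fun w => \sum_i \sum_j gam w i j * Z w i j).
    by apply/funext => w; rewrite frob_innerE.
  rewrite !E; apply: (cond_eq_sum Fm FS0) => i; apply: (cond_eq_sum Fm FS0) => j.
  apply: (cM _ _ _ Gm) => //; first exact: gb.
  exact: (condexp_on_cond_eq sF Fm FS0 (GY i j)).
apply: (cD).
  apply: (cM _ _ _ `|Gm / 2 * alp|); [exact: mp|exact: (pb (Gm / 2 * alp))|].
  exact: (condexp_on_cond_eq sF Fm FS0 GY2).
apply: (cD).
  apply: cond_eq_refl; apply: (@integrable_bounded _ _ _ _ _ _ (`|Gm / 2 / alp|)) => //.
    by apply: measurable_funTS; exact: (measurable_wrt_fun Fm (mp _)).
  exact: (pb (Gm / 2 / alp)).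
apply: (cM _ _ _ `|Gm / 2 / alp|).
- apply/(measurable_wrtP sF); apply: measurable_funN; apply/(measurable_wrtP sF).
  exact: mp.
- by move=> w; rewrite normrN; exact: (pb (Gm / 2 / alp)).
- exact: (condexp_on_cond_eq sF Fm FS0 GY3).
Qed.

Let Psi_le : {ae P, forall w, S0 w -> Psi w <= Gm * (b + Num.sqrt (V * dl))}.
Proof.
apply: filterS3 Yb Y2V Y3d => w hY h2 h3 S0w.
have [Sw|nSw] := pselect (S w); last first.
  rewrite /Psi /pen2 /pen3 indS asboolF // gamS //.
  rewrite -[X in frob_inner X](scale0r 0) !frob_innerZl !mul0r.
  by rewrite !mulr0 oppr0 mul0r !addr0 mulr_ge0 // addr_ge0 // sqrtr_ge0.
have {}hY := hY Sw; have {}h2 := h2 S0w; have {}h3 := h3 S0w.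
rewrite /Psi /pen2 /pen3 indS asboolT // !mul1r mulN1r -frob_innerBr mulrDr.
apply: lerD.
  apply: le_trans (ler_norm _) _; apply: le_trans (frob_cauchy_schwarz _ _) _.
  by apply: ler_pM; rewrite ?frob_norm_ge0 // frob_distC.
have sV : 0 < Num.sqrt V by rewrite sqrtr_gt0.
have sd : 0 < Num.sqrt dl by rewrite sqrtr_gt0.
have e1 : Gm / 2 * alp * Y2 w <= Gm / 2 * alp * V.
  by rewrite ler_wpM2l.
have e2 : Gm / 2 / alp * (1 - Y3 w) <= Gm / 2 / alp * dl.
  by apply: ler_wpM2l => //; lra.
have e3 : Gm / 2 * alp * V + Gm / 2 / alp * dl = Gm * Num.sqrt (V * dl).
  rewrite (sqrtrM _ (ltW V0)) /alp.
  have Vv := sqr_sqrtr (ltW V0); have du := sqr_sqrtr (ltW dl0).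
  move: sV sd Vv du; move: (Num.sqrt V) (Num.sqrt dl) => v u v0 u0 <- <-.
  by field; rewrite !gt_eqF.
lra.
Qed.

(** The conclusion has the form that the Chernoff bound takes as hypothesis. The integral is first
    confined to [S0], where the versions live and outside which the noise vanishes; the return to
    the whole space uses [0 <= X w * e]. *)
Lemma trunc_noise_bias (X : T -> R) (Cx : R) : measurable_wrt F X ->
  (forall w, 0 <= X w <= Cx) ->
  (\int[P]_w (X w * trunc_noise w)
     <= Gm * (b + Num.sqrt (V * dl)) * \int[P]_w X w)%R.
Proof.
move=> mX X01; set e := Gm * _.
have mS0 := Fm FS0.
have mXT : measurable_fun setT X := (measurable_wrt_fun Fm mX).
have mXS0 : measurable_fun S0 X by exact: measurable_funTS.
have e0 : 0 <= e by rewrite mulr_ge0 // addr_ge0 // sqrtr_ge0.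
have XC D w : D w -> `|X w| <= Cx.
  by move=> _; have /andP[x0 xc] := X01 w; rewrite ger0_norm.
have mz : measurable_fun setT trunc_noise.
  apply: (@measurable_trunc_noise _ T id) => // i j.
  exact: (measurable_wrt_fun Fm (mgam i j)).
have iz : P.-integrable S0 (EFin \o trunc_noise).
  apply: (@integrable_bounded _ _ _ _ _ _ (Gm * (M + Gm))) => //.
    exact: measurable_funTS.
  move=> w _; apply: le_trans (normr_trunc_noise w) _.
  by rewrite ler_wpM2r // addr_ge0.
have [iPhi iPsi ePP] := cond_eq_Phi_Psi.
have iXS Z : P.-integrable S0 (EFin \o Z) ->
    P.-integrable S0 (EFin \o (fun w => X w * Z w)).
  exact: (integrable_mul_bounded mS0 mXS0 (XC S0)).
have iX : P.-integrable setT (EFin \o X).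
  exact: (@integrable_bounded _ _ _ P _ _ Cx measurableT mXT (XC setT)).
have ie : P.-integrable S0 (EFin \o (fun=> e)).
  by apply: (@integrable_bounded _ _ _ _ _ _ (e)) => // w _; rewrite ger0_norm.
have -> : (\int[P]_w (X w * trunc_noise w) = \int[P]_(w in S0) (X w * trunc_noise w))%R.
  rewrite [RHS]Rintegral_mkcond; apply: eq_Rintegral => w _.
  rewrite patchE; case: ifPn => // /negP nS; rewrite trunc_noise_out ?mulr0 //.
  by move=> /SS0 Sw; apply: nS; rewrite inE.
apply: (@le_trans _ _ (\int[P]_(w in S0) (X w * Phi w))%R).
  apply: le_Rintegral => //; [exact: iXS|exact: iXS|].
  by move=> w _; rewrite ler_wpM2l ?noise_le_Phi //; have /andP[] := X01 w.
rewrite (ePP X Cx mX (XC S0)).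
apply: (@le_trans _ _ (\int[P]_(w in S0) (X w * e))%R).
  apply: ae_le_Rintegral => //; [exact: iXS|exact: iXS|].
  apply: filterS Psi_le => w h S0w; rewrite ler_wpM2l ?h //.
  by have /andP[] := X01 w.
have iXe : P.-integrable setT (EFin \o (fun w => X w * e)).
  apply: (@integrable_bounded _ _ _ _ _ _ (Cx * e)) => //.
    exact: measurable_funM.
  by move=> w _; rewrite normrM (ger0_norm e0) ler_wpM2r // (XC setT).
have S01 w : 0 <= (\1_S0 w : R) <= 1.
  by rewrite indicE; case: (_ \in _); rewrite ?lexx ler01.
have -> : (\int[P]_(w in S0) (X w * e) = \int[P]_w (\1_S0 w * (X w * e)))%R.
  by rewrite Rintegral_indicM // setTI.
rewrite mulrC -RintegralZr //; apply: le_Rintegral => //.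
  apply: (integrable_mul_bounded (c := 1)) => //.
  by move=> w _; have /andP[h0 h1] := S01 w; rewrite ger0_norm.
move=> w _; have /andP[h0 h1] := S01 w; rewrite ler_piMl // mulr_ge0 //.
by have /andP[] := X01 w.
Qed.

End NoiseStep.

(** * Real-valued consequences of the landscape inequalities *)

Section Suboptimality.
Variables (R : realType) (n m : nat).
Variables (A : 'M[R]_n) (B : 'M[R]_(n, m)) (Q : 'M[R]_n) (Rc : 'M[R]_m).
Hypotheses (hQ : sym_posdef Q) (hRc : sym_posdef Rc).
Variable D : probability (borel_mx R n 1) R.
Hypothesis hD : forall i j : 'I_n,
  (\int[D]_x ((x : 'cV[R]_n) i 0 * (x : 'cV[R]_n) j 0)%:E
   = ((1%:M : 'M[R]_n) i j)%:E)%E.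
Hypothesis hopt : lqr_opt A B Q Rc D \is a fin_num.

Local Notation cost := (lqr_cost A B Q Rc D).
Local Notation opt := (lqr_opt A B Q Rc D).
Local Notation subopt := (lqr_subopt A B Q Rc D).
Local Notation grad := (lqr_grad A B Q Rc D).
Implicit Types K : 'M[R]_(m, n).

Lemma lqr_subopt_ge0 K : (0 <= subopt K)%E.
Proof.
rewrite /lqr_subopt sube_ge0 // ?hopt ?orbT //.
by apply: ereal_inf_lbound; exists K.
Qed.

Lemma measurable_lqr_subopt : measurable_fun [set: borel_mx R m n]
  (fun K : borel_mx R m n => subopt (K : 'M[R]_(m, n))).
Proof.
apply: emeasurable_funB => //; exact: measurable_lqr_cost.
Qed.

Lemma measurable_subopt_lt (u : \bar R) :
  measurable ([set K | (subopt K < u)%E] : set (borel_mx R m n)).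
Proof.
have := measurable_lqr_subopt measurableT (emeasurable_itv `]-oo, u[).
rewrite setTI; congr measurable; apply/seteqP; split => K;
  by rewrite /= in_itv.
Qed.

Lemma measurable_subopt_le (u : \bar R) :
  measurable ([set K | (subopt K <= u)%E] : set (borel_mx R m n)).
Proof.
have := measurable_lqr_subopt measurableT (emeasurable_itv `]-oo, u]).
rewrite setTI; congr measurable; apply/seteqP; split => K;
  by rewrite /= in_itv.
Qed.

Lemma lqr_subopt_fineK K (u : R) : (subopt K <= u%:E)%E ->
  (fine (subopt K))%:E = subopt K.
Proof.
move=> Ku; rewrite fineK // ge0_fin_numE ?lqr_subopt_ge0 //.
exact: le_lt_trans Ku (ltry _).
Qed.

Lemma lqr_costE_subopt K : (cost K = subopt K + opt)%E.
Proof. by rewrite /lqr_subopt subeK. Qed.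

Lemma stable_subopt_fin K : stable A B K -> (subopt K < +oo)%E.
Proof.
move=> /(stable_lqr_cost_fin hQ hRc hD) Kfin.
by rewrite /lqr_subopt lte_add_pinfty // -(fineK hopt) -EFinN ltry.
Qed.

Variables (Delta mu L r : R).
Hypothesis r0 : 0 < r.
Hypothesis hland : forall K, (subopt K < Delta%:E)%E ->
  [/\ forall K' : 'M[R]_(m, n), frob_norm (K' - K) <= r ->
        stable A B K' /\
        (cost K' <= cost K
           + (frob_inner (grad K) (K' - K)
              + L / 2 * frob_norm (K - K') ^+ 2)%:E)%E,
      (mu%:E * subopt K <= (frob_norm (grad K) ^+ 2)%:E)%E &
      ((frob_norm (grad K) ^+ 2)%:E <= (2 * L)%:E * subopt K)%E].

Lemma subopt_descent K K' : (subopt K < Delta%:E)%E -> frob_norm (K' - K) <= r ->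
  (subopt K' <= (fine (subopt K) + (frob_inner (grad K) (K' - K)
              + L / 2 * frob_norm (K - K') ^+ 2))%:E)%E.
Proof.
move=> KD K'r; have [sm _ _] := hland KD; have [_ {}sm] := sm K' K'r.
rewrite EFinD (lqr_subopt_fineK (ltW KD)) {1}/lqr_subopt.
rewrite leeBlDr //; apply: le_trans sm _.
by rewrite lqr_costE_subopt addeAC.
Qed.

Lemma measurable_lqr_grad (i : 'I_m) (j : 'I_n) :
  measurable_fun ([set K | (subopt K < Delta%:E)%E] : set (borel_mx R m n))
    (fun K : borel_mx R m n => grad K i j).
Proof.
pose f (K : 'M[R]_(m, n)) : R := fine (cost K).
have mf : measurable_fun [set: borel_mx R m n] (f : borel_mx R m n -> R).
  apply: (measurableT_comp (f := @fine R)) => //.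
  exact: measurable_lqr_cost.
have smooth K K' : (subopt K < Delta%:E)%E -> frob_norm (K' - K) <= r ->
    f K' <= f K + frob_inner (gradient f K) (K' - K)
              + L / 2 * frob_norm (K - K') ^+ 2.
  move=> KD K'r; have [sm _ _] := hland KD; have [_ {}sm] := sm K' K'r.
  have Kfin : cost K \is a fin_num.
    by rewrite lqr_costE_subopt -(lqr_subopt_fineK (ltW KD)) fin_numD hopt.
  (* The upper bound itself forces the cost of [K'] to be finite, so the extended inequality passes
     to [fine]. *)
  have K'fin : cost K' \is a fin_num.
    rewrite ge0_fin_numE ?lqr_cost_ge0 //; apply: le_lt_trans sm _.
    by rewrite -(fineK Kfin) -EFinD ltry.
  by move: sm; rewrite -{1}(fineK Kfin) -{1}(fineK K'fin) -EFinD lee_fin addrA.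
exact (measurable_gradient_entry mf (measurable_subopt_lt _) r0 smooth i j).
Qed.

Lemma subopt_PL K : (subopt K < Delta%:E)%E ->
  mu * fine (subopt K) <= frob_norm (grad K) ^+ 2.
Proof.
move=> KD; have [_ h _] := hland KD.
by move: h; rewrite -(lqr_subopt_fineK (ltW KD)) -EFinM lee_fin.
Qed.

Lemma subopt_grad_le K : (subopt K < Delta%:E)%E ->
  frob_norm (grad K) ^+ 2 <= 2 * L * fine (subopt K).
Proof.
move=> KD; have [_ _ h] := hland KD.
by move: h; rewrite -(lqr_subopt_fineK (ltW KD)) -EFinM lee_fin.
Qed.

End Suboptimality.

Unset Implicit Arguments.

(** * The stochastic policy gradient iteration *)

Section StochasticPolicyGradient.
Variables (R : realType) (n m : nat).
Variables (A : 'M[R]_n) (B : 'M[R]_(n, m)) (Q : 'M[R]_n) (Rc : 'M[R]_m).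
Hypotheses (hQ : sym_posdef Q) (hRc : sym_posdef Rc).
Variable D : probability (borel_mx R n 1) R.
Hypothesis hD : forall i j : 'I_n,
  (\int[D]_x ((x : 'cV[R]_n) i 0 * (x : 'cV[R]_n) j 0)%:E
   = ((1%:M : 'M[R]_n) i j)%:E)%E.
Hypothesis hopt : lqr_opt A B Q Rc D \is a fin_num.

Local Notation subopt := (lqr_subopt A B Q Rc D).
Local Notation grad := (lqr_grad A B Q Rc D).

Variables (mu L r D0 b V M dl N : R).
Hypotheses (mu0 : 0 < mu) (L0 : 0 < L) (r0 : 0 < r) (D00 : 0 < D0).
Hypotheses (b0 : 0 <= b) (V0 : 0 < V) (M0 : 0 < M) (dl0 : 0 < dl) (dl1 : dl < 1).

Let Delta := 6 * D0.
Let GD := 2 * Num.sqrt (L * Delta).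
Let kap := L / mu ^+ 2.
Let H := (M + GD) ^+ 2.
Let l := ln (1 / dl).
Let Bias := GD * (b + Num.sqrt (V * dl)) / mu.
Let cD := 8 * kap * (M ^+ 2 + 768 * H * l).
Let C := 2 * (N * D0 + cD).
Let bound (t : nat) := 2 * Bias + C / (N + t%:R).
Let eta (t : nat) := 2 / (mu * (N + t%:R)).

Hypothesis hland : forall K, (subopt K < Delta%:E)%E ->
  [/\ forall K' : 'M[R]_(m, n), frob_norm (K' - K) <= r ->
        stable A B K' /\
        (lqr_cost A B Q Rc D K' <= lqr_cost A B Q Rc D K
           + (frob_inner (grad K) (K' - K)
              + L / 2 * frob_norm (K - K') ^+ 2)%:E)%E,
      (mu%:E * subopt K <= (frob_norm (grad K) ^+ 2)%:E)%E &
      ((frob_norm (grad K) ^+ 2)%:E <= (2 * L)%:E * subopt K)%E].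
Hypotheses (N4 : 4 <= N) (Nr : 2 * M / (mu * r) <= N) (ND : cD <= N * D0).
Hypothesis hBias : Bias <= D0.

Context (d : measure_display) (Omega : measurableType d).
Variables (P : probability Omega R) (F : nat -> set (set Omega)).
Hypothesis hF : filtration F.
Variables K G : nat -> Omega -> 'M[R]_(m, n).
Hypothesis hK : forall t, measurable_wrt (U := borel_mx R m n) (F t) (K t).
Hypothesis hG : forall t, measurable_wrt (U := borel_mx R m n) (F t.+1) (G t).
Hypothesis hnoise : forall t,
  noise_bounds A B Q Rc D P F K G Delta dl b V M t.
Hypothesis hinit : forall w, subopt (K 0%N w) = D0%:E.
Hypothesis hstep : forall t w, K t.+1 w = K t w - eta t *: G t w.

Let sF t : sigma_algebra [set: Omega] (F t). Proof. by case: hF. Qed.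
Let Fm t : F t `<=` measurable. Proof. by case: hF. Qed.

Let S0 (t : nat) : set Omega := [set w | (subopt (K t w) <= Delta%:E)%E].
(* The strict inequality is needed by the landscape constants; it only matters
   at [t = 0], where [bound 0] may equal [Delta]. *)
Let U (t : nat) : set (borel_mx R m n) :=
  [set X | (subopt X < Delta%:E)%E] `&` [set X | (subopt X <= (bound t)%:E)%E].
Let S (t : nat) : set Omega := K t @^-1` U t.
(** The cut-off tests only the current iterate, so it is a Borel function of [K t]; being 0 outside
    [U t], it is bounded on the whole space. *)
Let gamK (t : nat) (X : 'M[R]_(m, n)) : 'M[R]_(m, n) :=
  if `[< U t X >] then grad X else 0.
Let gam (t : nat) (w : Omega) := gamK t (K t w).
Let wt (t : nat) := 2 * (N + t%:R - 1) / mu.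
Let zeta (t : nat) (w : Omega) := trunc_noise (G t) (gam t) M w.
Let rng (t : nat) := (M + GD) * Num.sqrt (2 * L * bound t).

Let Delta_gt0 : 0 < Delta. Proof. by rewrite mulr_gt0. Qed.
Let GD_ge0 : 0 <= GD. Proof. by rewrite mulr_ge0 ?sqrtr_ge0. Qed.
Let l_gt0 : 0 < l.
Proof. by rewrite /l div1r lnV ?posrE // oppr_gt0 ln_lt0 // dl0. Qed.
Let kap_gt0 : 0 < kap. Proof. by rewrite divr_gt0 ?exprn_gt0. Qed.
Let H_gt0 : 0 < H. Proof. by rewrite exprn_gt0 // ltr_wpDr. Qed.
Let Bias_ge0 : 0 <= Bias.
Proof.
by apply: divr_ge0; [apply: mulr_ge0 => //; rewrite addr_ge0 ?sqrtr_ge0|exact: ltW].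
Qed.
Let cD_ge0 : 0 <= cD.
Proof.
apply: mulr_ge0; first by apply: mulr_ge0; [exact: ler0n|exact: ltW].
apply: addr_ge0; first exact: sqr_ge0.
apply: mulr_ge0; last exact: ltW.
by apply: mulr_ge0; [exact: ler0n|exact: ltW].
Qed.
Let N_gt0 (t : nat) : 0 < N + t%:R.
Proof. by have := ler0n R t; have := N4; lra. Qed.
Let C_gt0 : 0 < C.
Proof.
apply: mulr_gt0 => //; apply: ltr_pwDl => //; apply: mulr_gt0 => //.
by have := N4; lra.
Qed.
Let bound_gt0 t : 0 < bound t.
Proof.
by rewrite ltr_wpDl // ?divr_gt0 // mulr_ge0.
Qed.

(** The origin of the 6 in [Delta]: [hBias] gives [2 * Bias <= 2 * D0] and [ND] gives
    [C <= 4 * N * D0]; strictness comes from [N < N + t]. *)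
Let bound_lt t : (0 < t)%N -> bound t < Delta.
Proof.
move=> t0; have t1 : 0 < t%:R :> R by rewrite ltr0n.
have h : C / (N + t%:R) < 4 * D0.
  rewrite ltr_pdivrMr //; have Dt : 0 < D0 * t%:R by rewrite mulr_gt0.
  have -> : 4 * D0 * (N + t%:R) = 4 * (N * D0) + 4 * (D0 * t%:R) by ring.
  by rewrite /C; have := ND; lra.
rewrite /bound /Delta; have := hBias; lra.
Qed.

Let FS0 t : F t (S0 t).
Proof. exact (@hK t _ (measurable_subopt_le A B hQ hRc hD Delta%:E)). Qed.

Let mU t : measurable (U t).
Proof.
by apply: measurableI; [exact: measurable_subopt_lt|exact: measurable_subopt_le].
Qed.

Let FS t : F t (S t). Proof. exact (@hK t _ (mU t)). Qed.

Let SS0 t : S t `<=` S0 t. Proof. by move=> w [h _]; exact: ltW. Qed.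

Let measurable_gamK t i j : measurable_fun [set: borel_mx R m n]
  (fun X : borel_mx R m n => gamK t X i j).
Proof.
rewrite (_ : (fun X => _) = (fun X : borel_mx R m n => grad X i j) \_ (U t)).
  apply/(measurable_restrictT _ (mU t)).
  apply: (measurable_funS _ _ (measurable_lqr_grad hQ hRc hD hopt r0 hland i j)).
    exact: measurable_subopt_lt.
  by move=> X [].
apply/funext => X; rewrite /gamK patchE; case: asboolP => UX.
  by rewrite mem_set.
by rewrite memNset // mxE.
Qed.

Let mgam t i j : measurable_wrt (F t) (fun w => gam t w i j).
Proof.
apply/(measurable_wrtP (sF t)).
apply: (measurableT_comp (measurable_gamK t i j)).
exact/(measurable_wrtP (sF t)).
Qed.

Let mGe t i j : measurable_wrt (F t.+1) (fun w => G t w i j).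
Proof.
apply/(measurable_wrtP (sF t.+1)).
apply: (measurableT_comp (measurable_entry i j)).
exact/(measurable_wrtP (sF t.+1)).
Qed.

Let gam_in t w : S t w -> gam t w = grad (K t w).
Proof. by move=> Sw; rewrite /gam /gamK asboolT. Qed.

Let gam_out t w : ~ S t w -> gam t w = 0.
Proof. by move=> Sw; rewrite /gam /gamK asboolF. Qed.

Let gam_bound t w : frob_norm (gam t w) <= Num.sqrt (2 * L * bound t).
Proof.
have [Sw|nSw] := pselect (S t w); last first.
  by rewrite gam_out // -(scale0r 0) frob_normZ normr0 mul0r sqrtr_ge0.
rewrite gam_in //; have [Kl Kb] := Sw.
rewrite -[leLHS]ger0_norm ?frob_norm_ge0 // -sqrtr_sqr ler_wsqrtr //.
apply: le_trans (subopt_grad_le hopt hland Kl) _.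
rewrite ler_pM2l ?mulr_gt0 // -lee_fin.
by rewrite (lqr_subopt_fineK hopt Kb).
Qed.

Let gam_GD t w : frob_norm (gam t w) <= GD.
Proof.
have [Sw|nSw] := pselect (S t w); last first.
  by rewrite gam_out // -(scale0r 0) frob_normZ normr0 mul0r.
rewrite gam_in //; have [Kl Kb] := Sw.
rewrite -ler_sqr ?nnegrE ?frob_norm_ge0 //.
apply: le_trans (subopt_grad_le hopt hland Kl) _.
rewrite /GD exprMn sqr_sqrtr ?mulr_ge0 ?ltW //.
have : fine (subopt (K t w)) <= Delta.
  by rewrite -lee_fin (lqr_subopt_fineK hopt Kb) ltW.
rewrite -(ler_pM2l L0); have := mulr_gt0 L0 Delta_gt0; lra.
Qed.

Let wt_ge0 t : 0 <= wt t.
Proof.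
by apply: divr_ge0; [have := ler0n R t; have := N4; lra|exact: ltW].
Qed.

Let zeta_bound t w : `|wt t * zeta t w| <= wt t * rng t.
Proof.
rewrite normrM ger0_norm // ler_wpM2l //.
apply: le_trans (normr_trunc_noise (G t) (ltW M0) (gam_GD t) w) _.
by rewrite /rng mulrC ler_wpM2l // addr_ge0 // ltW.
Qed.

Let mzeta t : measurable_wrt (F t.+1) (fun w => wt t * zeta t w).
Proof.
apply/(measurable_wrtP (sF t.+1)); apply: measurable_funM => //.
have mg i j : measurable_wrt (F t.+1) (fun w => gam t w i j).
  exact (measurable_wrt_le hF (leqnSn t) (mgam t i j)).
exact (@measurable_trunc_noise _ _ Omega _ _ (G t) (gam t) M _
  (g_sigma_algebraType (F t.+1)) (fun w => w)
  (fun i j => (measurable_wrtP (sF t.+1) _).1 (mGe t i j))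
  (fun i j => (measurable_wrtP (sF t.+1) _).1 (mg i j))).
Qed.

Let zeta_bias t (X : Omega -> R) Cx : measurable_wrt (F t) X ->
  (forall w, 0 <= X w <= Cx) ->
  (\int[P]_w (X w * (wt t * zeta t w)) <= (wt t * (mu * Bias)) * \int[P]_w X w)%R.
Proof.
move=> mX X01.
have [[Y hY Yb] [Y2 hY2 Y2V] [Y3 hY3 Y3d]] := hnoise t.
have mGT i j : measurable_fun setT (fun w => G t w i j).
  exact (measurable_wrt_fun (Fm t.+1) (mGe t i j)).
have Yb' : {ae P, forall w, S t w -> frob_norm (Y w - gam t w) <= b}.
  by apply: filterS Yb => w h Sw; rewrite gam_in //; apply: h; exact: SS0.
have h := trunc_noise_bias (sF t) (Fm t) (FS0 t) (FS t) (SS0 t) V0 dl0 b0 (ltW M0)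
  mGT (mgam t) (gam_out t) (gam_GD t) hY Yb' hY2 Y2V hY3 Y3d mX X01.
have XC w : setT w -> `|X w| <= Cx.
  by move=> _; have /andP[x0 xc] := X01 w; rewrite ger0_norm.
have mzT : measurable_fun setT (zeta t).
  exact (@measurable_trunc_noise _ _ Omega _ _ (G t) (gam t) M _ Omega (fun w => w)
    mGT (fun i j => measurable_wrt_fun (Fm t) (mgam t i j))).
have iz : P.-integrable setT (EFin \o zeta t).
  apply: (@integrable_bounded _ _ _ P _ _ (GD * (M + GD))) => // w _.
  apply: le_trans (normr_trunc_noise (G t) (ltW M0) (gam_GD t) w) _.
  by rewrite ler_wpM2r // addr_ge0 // ltW.
have iXz : P.-integrable setT (EFin \o (fun w => X w * zeta t w)).
  apply: (integrable_mul_bounded measurableT _ XC iz).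
  exact (measurable_wrt_fun (Fm t) mX).
rewrite (@eq_Rintegral _ _ _ _ _ (fun w => wt t * (X w * zeta t w))); last first.
  by move=> w _; rewrite mulrCA.
rewrite RintegralZl // -mulrA ler_wpM2l //; apply: le_trans h _.
by rewrite /Bias [mu * _]mulrC divfK // gt_eqF.
Qed.

(** The Chernoff parameter is tuned to the horizon [t], hence a separate event for each time instead
    of one maximal inequality. *)
Let lam (t : nat) := (64 * (N + t%:R - 1) * kap * H)^-1.
Let csum (t : nat) := \sum_(s < t) wt s * (mu * Bias)
  + 2 * lam t * (\sum_(s < t) (wt s * rng s) ^+ 2) + l / lam t.
(** A large estimate is counted only on [S0 t], where the noise condition controls its
    probability. *)
Let bad_noise (t : nat) := S0 t `&` ~` [set w | frob_norm (G t w) <= M].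
Let bad_sum (t : nat) := [set w | csum t <= \sum_(s < t) wt s * zeta s w].

Let good_step t w : S t w -> frob_norm (G t w) <= M ->
  (subopt (K t.+1 w) <=
    (fine (subopt (K t w)) - eta t * (mu * fine (subopt (K t w)) - zeta t w)
       + L / 2 * (eta t * M) ^+ 2)%:E)%E.
Proof.
move=> Sw GM; have [Kl Kb] := Sw.
have eta0 : 0 < eta t by rewrite divr_gt0 // mulr_gt0.
have dK : frob_norm (K t.+1 w - K t w) = eta t * frob_norm (G t w).
  by rewrite hstep addrAC subrr add0r frob_normN frob_normZ gtr0_norm.
(* This is what the term [2 * M / (mu * r)] in the choice of [N] is for. *)
have etaM : eta t * M <= r.
  rewrite /eta mulrAC ler_pdivrMr ?mulr_gt0 // mulrCA mulrA.
  move: Nr; rewrite ler_pdivrMr ?mulr_gt0 // => h; apply: le_trans h _.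
  rewrite [leRHS]mulrC; apply: ler_wpM2r; last by rewrite lerDl.
  by rewrite mulr_ge0 // ltW.
have Kr : frob_norm (K t.+1 w - K t w) <= r.
  by rewrite dK; apply: le_trans etaM; rewrite ler_pM2l.
apply: le_trans (subopt_descent hopt hland Kl Kr) _; rewrite lee_fin.
rewrite -addrA lerD2l; apply: lerD.
  (* As [G t w] is not truncated here, its inner product with the gradient is the squared gradient
     norm minus [zeta t w]; the PL inequality bounds that norm from below. *)
  rewrite hstep addrAC subrr add0r -scaleNr frob_innerZr mulNr lerN2 ler_pM2l //.
  rewrite /zeta trunc_noise_in // gam_in // frob_innerBr -frob_norm_sqr.
  by have := subopt_PL hopt hland Kl; lra.
apply: ler_wpM2l; first by apply: divr_ge0 => //; exact: ltW.
rewrite frob_distC dK ler_sqr ?nnegrE; first by rewrite ler_pM2l.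
  by apply: mulr_ge0; [exact: ltW|exact: frob_norm_ge0].
by apply: mulr_ge0; exact: ltW.
Qed.

(** The induction is strong because the weighted inequality at time [t + 1] unrolls the recursion
    back to time 0 and so uses [S s] for all [s <= t]. *)
Let good_bound w T :
  (forall t, (t < T)%N -> ~ bad_noise t w) ->
  (forall t, (t < T)%N -> ~ bad_sum t.+1 w) ->
  forall t, (t <= T)%N -> S t w.
Proof.
move=> gn gs t; elim/ltn_ind: t => -[|t] IH tT.
  have D0D : D0 < Delta by rewrite /Delta; have := D00; lra.
  split; rewrite /= hinit ?lte_fin ?lee_fin // /bound addr0.
  have N0 := N_gt0 0%N; rewrite addr0 in N0.
  apply: ler_wpDl; first by rewrite mulr_ge0.
  rewrite ler_pdivlMr // /C; have := mulr_gt0 N0 D00; have := cD_ge0; lra.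
have Ss s : (s < t.+1)%N -> S s w.
  by move=> st; apply: IH => //; apply: leq_trans tT; exact: ltnW.
have GM s : (s < t.+1)%N -> frob_norm (G s w) <= M.
  move=> st; apply: contrapT => nGM; apply: (gn s (leq_trans st tT)).
  by split => //; apply: SS0; exact: Ss.
pose x s := fine (subopt (K s w)).
have step s (st : (s < t.+1)%N) := good_step s w (Ss s st) (GM s st).
have xstep s : (s < t.+1)%N -> x s.+1 <= x s - eta s * (mu * x s - zeta s w)
     + L / 2 * (eta s * M) ^+ 2.
  by move=> st; rewrite -lee_fin (lqr_subopt_fineK hopt (step s st)); exact: step.
have xb : x t.+1 <= bound t.+1.
  apply: (@rate_of_weighted_bound R kap M H l Bias N D0 _ (lam t.+1)
    (fun s => (wt s * rng s) ^+ 2)) => //; [exact: ltW|exact: ltW| |].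
    (* Equality holds: [4 / mu^2] from the squared weight and [2 * L] from the squared gradient
       range combine into [8 * kap]. *)
    move=> s _; rewrite le_eqVlt; apply/orP; left; apply/eqP.
    have bs : 0 <= 2 * L * bound s by rewrite mulr_ge0 ?ltW // mulr_gt0.
    rewrite [LHS](exprMn 2 (wt s)) {1}/rng (exprMn 2 (M + GD)) (sqr_sqrtr bs).
    rewrite -/H /wt -/(bound s) /kap.
    by field; rewrite gt_eqF.
  have := weighted_descent mu0 L0 N4 xstep.
  rewrite (_ : N + t.+1%:R - 2 = N + t.+1%:R - 1 - 1); last by ring.
  move=> h; apply: le_trans h _.
  have -> : x 0%N = D0 by rewrite /x hinit.
  apply: lerD; last exact: lexx.
  rewrite lerD2l.
  have /negP := gs t tT; rewrite /bad_sum /= -ltNge => /ltW {}h.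
  apply: le_trans h _; rewrite /csum !lerD2r; apply: ler_sum => s _.
  by rewrite /wt mulrA divfK ?gt_eqF.
have := xb; rewrite -lee_fin (lqr_subopt_fineK hopt (step t (ltnSn t))) => Kb.
by split => //=; apply: le_lt_trans Kb _; rewrite lte_fin bound_lt.
Qed.

Let measurable_bad_noise t : measurable (bad_noise t).
Proof.
have mGT : measurable_mx (G t).
  by move=> i j; exact (measurable_wrt_fun (Fm t.+1) (mGe t i j)).
have mN : measurable_fun setT (fun w => frob_inner (G t w) (G t w)).
  exact: measurable_frob_inner.
apply: measurableI; first exact: Fm (FS0 t).
apply: measurableC.
have := mN measurableT `]-oo, M ^+ 2]%classic (measurable_itv _).
rewrite setTI; congr measurable; apply/seteqP; split => w;
  by rewrite /= in_itv /= -frob_norm_sqr ler_sqr ?nnegrE ?frob_norm_ge0 ?(ltW M0).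
Qed.

(** Integrating the version [Y3] over [S0 t] shows that the estimate is small on at least a fraction
    [1 - dl] of [S0 t]. *)
Let prob_bad_noise t : (P (bad_noise t) <= dl%:E)%E.
Proof.
have [_ _ [Y3 hY3 Y3d]] := hnoise t; have [_ i1 iY XY] := hY3.
have mS0 : measurable (S0 t) := Fm t _ (FS0 t).
pose J := [set w | frob_norm (G t w) <= M].
have mB := measurable_bad_noise t.
have mSJ : measurable (S0 t `&` J).
  have -> : S0 t `&` J = S0 t `\` bad_noise t.
    apply/seteqP; split => w [Sw]; first by move=> Jw; split=> // -[_]; apply.
    by move=> nB; split=> //; apply: contrapT => nJ; exact: nB.
  exact: measurableD.
have e1 : (\int[P]_(w in S0 t) \1_J w)%R = fine (P (S0 t `&` J)).
  rewrite (@eq_Rintegral _ _ _ _ _ (\1_(S0 t `&` J) : Omega -> R)).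
    by rewrite /Rintegral integral_indic // setIAC setIid.
  by move=> w wS; rewrite !indicE in_setI wS.
have e2 : (1 - dl) * fine (P (S0 t)) <= fine (P (S0 t `&` J)).
  rewrite -e1 /Rintegral -(XY _ (FS0 t) (fun w Sw => Sw)) -/(Rintegral _ _ _).
  rewrite -Rintegral_cst //; apply: ae_le_Rintegral => //.
  apply: (@integrable_bounded _ _ _ P _ _ `|1 - dl|) => //.
have e3 : P (S0 t) = (P (bad_noise t) + P (S0 t `&` J))%E.
  rewrite -measureU //; last first.
    by rewrite -subset0 => w [[_ nJ] [_ Jw]]; exact: nJ.
  congr (P _); apply/seteqP; split => [w Sw|w [[]|[]]//].
  by have [Jw|nJ] := pselect (J w); [right|left].
have f1 : P (bad_noise t) \is a fin_num by exact: fin_num_measure.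
have f2 : P (S0 t `&` J) \is a fin_num by exact: fin_num_measure.
have e4 : fine (P (S0 t)) = fine (P (bad_noise t)) + fine (P (S0 t `&` J)).
  by rewrite e3 fineD.
have e5 : fine (P (S0 t)) <= 1.
  by rewrite -lee_fin fineK ?fin_num_measure //; exact: probability_le1.
rewrite -(fineK f1) lee_fin.
have : dl * fine (P (S0 t)) <= dl by rewrite ler_piMr // ltW.
lra.
Qed.

Let prob_bad_sum t : (P (bad_sum t) <= dl%:E)%E.
Proof.
have lam0 : 0 < lam t.
  rewrite invr_gt0; apply: mulr_gt0 => //; apply: mulr_gt0 => //.
  by apply: mulr_gt0 => //; have := ler0n R t; have := N4; lra.
have e0 s : 0 <= wt s * (mu * Bias).
  by apply: mulr_ge0 => //; apply: mulr_ge0 => //; exact: ltW.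
exact (@chernoff_partial_sum R d Omega P F hF (fun s w => wt s * zeta s w)
  (fun s => wt s * rng s) (fun s => wt s * (mu * Bias))
  mzeta zeta_bound e0 zeta_bias (lam t) dl t lam0 dl0).
Qed.

Let measurable_bad_sum t : measurable (bad_sum t).
Proof.
have mS : measurable_fun setT (fun w => \sum_(s < t) wt s * zeta s w).
  apply: measurable_sum => s; exact (measurable_wrt_fun (Fm _) (mzeta s)).
have := mS measurableT `[csum t, +oo[%classic (measurable_itv _).
rewrite setTI; congr measurable; apply/seteqP; split => w;
  by rewrite /= in_itv /= andbT.
Qed.

Lemma spg_high_probability (T : nat) :
  ((1 - 2 * T%:R * dl)%:E <= P [set w | forall t : nat, (t <= T)%N ->
     (subopt (K t w) <= (bound t)%:E)%E])%E.
Proof.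
set E := [set w | _].
have mE : measurable E.
  rewrite (_ : E = \bigcap_(t in [set t | (t <= T)%N])
      [set w | (subopt (K t w) <= (bound t)%:E)%E]) //.
  apply: bigcap_measurable => [|t _]; first by exists 0%N.
  apply: (Fm t).
  exact (@hK t _ (measurable_subopt_le A B hQ hRc hD (bound t)%:E)).
pose B1 := \big[setU/set0]_(t < T) bad_noise t.
(* The shift matters: the bound at time 0 holds outright, so only the sums at times 1 to [T] are
   charged. *)
pose B2 := \big[setU/set0]_(t < T) bad_sum t.+1.
have mB1 : measurable B1 by apply: bigsetU_measurable => t _; exact: measurable_bad_noise.
have mB2 : measurable B2 by apply: bigsetU_measurable => t _; exact: measurable_bad_sum.
have sub : ~` E `<=` B1 `|` B2.
  move=> w; apply: contra_notP => nB t tT.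
  have notin (X : nat -> set Omega) : ~ (\big[setU/set0]_(s < T) X s) w ->
      forall s, (s < T)%N -> ~ X s w.
    by move=> nX s sT Xs; apply: nX; rewrite -bigcup_mkord; exists s.
  have n1 : ~ B1 w by move=> h; apply: nB; left.
  have n2 : ~ B2 w by move=> h; apply: nB; right.
  by have [] := good_bound w T (notin _ n1) (notin (fun t => bad_sum t.+1) n2) t tT.
have sumT : (\sum_(t < T) dl%:E = (T%:R * dl)%:E :> \bar R)%E.
  by rewrite sumEFin sumr_const card_ord mulr_natl.
have PB : (P (~` E) <= (2 * T%:R * dl)%:E)%E.
  apply: le_trans (le_measure P _ _ sub) _; rewrite ?inE.
  - exact: measurableC.
  - exact: measurableU.
  apply: le_trans (measureU2 P mB1 mB2) _.
  rewrite -mulrA mulr_natl mulr2n EFinD; apply: leeD.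
    apply: le_trans (Boole_inequality P _) _ => [t _|]; first exact: measurable_bad_noise.
    by rewrite -sumT; apply: lee_sum => t _; exact: prob_bad_noise.
  apply: le_trans (Boole_inequality P (A := fun t => bad_sum t.+1) _) _ => [t _|].
    exact: measurable_bad_sum.
  by rewrite -sumT; apply: lee_sum => t _; exact: prob_bad_sum.
rewrite -[E]setCK probability_setC; last exact: measurableC.
by rewrite EFinB leeB.
Qed.

End StochasticPolicyGradient.

Theorem theorem3p2 (R : realType) (n m : nat)
  (A : 'M[R]_n) (B : 'M[R]_(n, m)) (Q : 'M[R]_n) (Rc : 'M[R]_m)
  (hQ : sym_posdef Q) (hRc : sym_posdef Rc)
  (D : probability (borel_mx R n 1) R) (DX : R) (hDX : 0 < DX)
  (hD : isotropic_bounded D DX)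
  (hmin : lqr_min_finite A B Q Rc D)
  (mu : R) (L r : R -> R) (hland : landscape A B Q Rc D mu L r)
  (d : measure_display) (Omega : measurableType d) (P : probability Omega R)
  (F : nat -> set (set Omega)) (hF : filtration F)
  (K G : nat -> Omega -> 'M[R]_(m, n))
  (hK : forall t, measurable_wrt (U := borel_mx R m n) (F t) (K t))
  (hG : forall t, measurable_wrt (U := borel_mx R m n) (F t.+1) (G t))
  (b : R -> R -> R) (V : R -> R) (M : R -> R -> R)
  (hnoise : noise_condition A B Q Rc D P F K G b V M)
  (K0 : 'M[R]_(m, n)) (hK0 : stable A B K0)
  (hDelta0 : (0 < lqr_subopt A B Q Rc D K0)%E)
  (T : nat) (hT : (1 <= T)%N) (delta : R) (hdelta : 0 < delta < 1) :
  let Delta0 := fine (lqr_subopt A B Q Rc D K0) in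
  let Delta := 6 * Delta0 in
  let GD := 2 * Num.sqrt (L Delta * Delta) in
  let bD := b Delta delta in
  let VD := V Delta in
  let MD := M Delta delta in
  let cD := 8 * L Delta / mu ^+ 2 *
            (MD ^+ 2 + 768 * (MD + GD) ^+ 2 * ln (1 / delta)) in
  let N : R := (Num.ceil (Num.max 4 (Num.max (2 * MD / (mu * r Delta))
                                             (cD / Delta0))))%:~R in
  let C := 2 * (N * Delta0 + cD) in
  let eta := fun t : nat => 2 / (mu * (N + t%:R)) in
  GD * (bD + Num.sqrt (VD * delta)) / mu <= Delta0 ->
  (forall w, K 0%N w = K0) ->
  (forall t w, K t.+1 w = K t w - eta t *: G t w) ->
  ((1 - 2 * T%:R * delta)%:E <=
   P [set w | forall t : nat, (t <= T)%N ->
        lqr_subopt A B Q Rc D (K t w) <=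
        (2 * GD * (bD + Num.sqrt (VD * delta)) / mu + C / (N + t%:R))%:E])%E.
Proof.
move=> D0 Delta GD bD VD MD cD N C eta hbias hinit hstep.
have [hopt _] := hmin; have [hmom _] := hD.
(* Stability makes the initial suboptimality finite, so [fine] in [D0] loses nothing and positivity
   carries over. *)
have K0fin := stable_subopt_fin hQ hRc hmom hopt hK0.
have D00 : 0 < D0 by rewrite fine_gt0 // hDelta0 K0fin.
have D0E : (D0%:E = lqr_subopt A B Q Rc D K0)%E.
  by rewrite fineK // ge0_fin_numE // ltW.
have Delta0 : 0 < Delta by rewrite mulr_gt0.
have [mu0 hl] := hland; have [L0 r0 hlK] := hl Delta Delta0.
have [b0 V0 M0 hn] := hnoise Delta delta Delta0 hdelta.
have /andP[dl0 dl1] := hdelta.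
pose D' := 8 * (L Delta / mu ^+ 2) *
  (MD ^+ 2 + 768 * (MD + GD) ^+ 2 * ln (1 / delta)).
have cDE : cD = D' by rewrite /cD /D' mulrA.
have NE : Num.max 4 (Num.max (2 * MD / (mu * r Delta)) (cD / D0)) <= N.
  exact: ceil_ge.
have [N4 Nr ND] : [/\ 4 <= N, 2 * MD / (mu * r Delta) <= N & D' <= N * D0].
  move: NE; rewrite !ge_max => /and3P[N4 Nr ND]; split=> //.
  by rewrite -cDE -ler_pdivrMr.
have hinit' w : lqr_subopt A B Q Rc D (K 0%N w) = D0%:E by rewrite hinit.
have := @spg_high_probability R n m A B Q Rc hQ hRc D hmom hopt mu (L Delta)
  (r Delta) D0 bD VD MD delta N mu0 L0 r0 D00 b0 V0 M0 dl0 dl1 hlK N4 Nr ND hbias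
  d Omega P F hF K G hK hG hn hinit' hstep T.
have boundE t : 2 * (GD * (bD + Num.sqrt (VD * delta)) / mu) +
    2 * (N * D0 + D') / (N + t%:R) =
    2 * GD * (bD + Num.sqrt (VD * delta)) / mu + C / (N + t%:R) :> R.
  by rewrite /C cDE; congr (_ + _); rewrite !mulrA.
congr (_ <= P _)%E; apply/seteqP; split => w h t tT; have := h t tT;
  by rewrite boundE.
Qed.
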